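(* Let $\Gamma$ be a finitely generated group. There is a natural bijection between $X(\Gamma)$ and the set of characters $\{\chi_\rho \mid \rho\in R(\Gamma)\}$. This bijection maps every $t(\rho)\in X(\Gamma)$ (with $\rho\in R(\Gamma)$) to the character $\chi_\rho$.
   Context: $R(\Gamma)$ is the set of all homomorphisms $\rho:\Gamma\to \mathrm{PSL}_2(\mathbb{C})$. It is an affine algebraic set over $\mathbb{C}$: for a presentation of $\Gamma$ with generators $\gamma_1,\dots,\gamma_s$, embed $R(\Gamma)\to \mathrm{PSL}_2(\mathbb{C})^s$ by $\rho\mapsto(\rho(\gamma_1),\dots,\rho(\gamma_s))$, with equations induced by the relations, where $\mathrm{PSL}_2(\mathbb{C})\cong \mathrm{SO}_3(\mathbb{C})$ (adjoint representation) is an affine algebraic group. The group $\mathrm{PSL}_2(\mathbb{C})$ acts on $R(\Gamma)$ by conjugation, and $X(\Gamma)=R(\Gamma)/\!/\mathrm{PSL}_2(\mathbb{C})$ is the quotient of invariant theory: the affine algebraic set with a regular map $t:R(\Gamma)\to X(\Gamma)$ inducing an isomorphism $t^*:\mathbb{C}[X(\Gamma)]\to\mathbb{C}[R(\Gamma)]^{\mathrm{PSL}_2(\mathbb{C})}$, where $\mathbb{C}[\cdot]$ is the ring of regular functions. The character of $\rho\in R(\Gamma)$ is the map $\chi_\rho:\Gamma\to\mathbb{C}$, $\chi_\rho(\gamma)=\mathrm{tr}^2(\rho(\gamma))$, where $\mathrm{tr}^2(\pm A)=(\mathrm{tr}\,A)^2$ for $A\in \mathrm{SL}_2(\mathbb{C})$.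 *)

(* Defs.v *)
From HB Require Import structures.
From mathcomp Require Import mpoly.
From mathcomp Require Import all_boot all_order all_algebra.
From mathcomp Require Import boolp classical_sets functions reals.
From mathcomp Require Import complex ring.

Set Implicit Arguments.
Unset Strict Implicit.
Unset Printing Implicit Defensive.

Import Order.TTheory GRing.Theory Num.Theory.
Local Open Scope ring_scope.
Local Open Scope quotient_scope.
Local Open Scope classical_set_scope.

Section SL2.
Variable F : fieldType.

Record SL2 := MkSL2 { sl2val :> 'M[F]_2; sl2_det : \det sl2val == 1 }.

HB.instance Definition _ := [isSub for sl2val].
HB.instance Definition _ := [Choice of SL2 by <:].

Lemma sl2_unit (A : SL2) : (A : 'M_2) \in unitmx.
Proof. by rewrite unitmxE (eqP (sl2_det A)) unitr1. Qed.

Fact sl2_one_subproof : \det (1%:M : 'M[F]_2) == 1.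
Proof. by rewrite det1. Qed.
Definition sl2_one := MkSL2 sl2_one_subproof.

Fact sl2_mul_subproof (A B : SL2) : \det (A *m B) == 1.
Proof. by rewrite det_mulmx (eqP (sl2_det A)) (eqP (sl2_det B)) mulr1. Qed.
Definition sl2_mul A B := MkSL2 (sl2_mul_subproof A B).

Fact sl2_inv_subproof (A : SL2) : \det (invmx A) == 1.
Proof. by rewrite det_inv (eqP (sl2_det A)) invr1. Qed.
Definition sl2_inv A := MkSL2 (sl2_inv_subproof A).

Fact sl2_mulA : associative sl2_mul.
Proof. by move=> A B D; apply: val_inj; rewrite /= mulmxA. Qed.
Fact sl2_mul1g : left_id sl2_one sl2_mul.
Proof. by move=> A; apply: val_inj; rewrite /= mul1mx. Qed.
Fact sl2_mulg1 : right_id sl2_one sl2_mul.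
Proof. by move=> A; apply: val_inj; rewrite /= mulmx1. Qed.
Fact sl2_mulVg : left_inverse sl2_one sl2_inv sl2_mul.
Proof. by move=> A; apply: val_inj; rewrite /= mulVmx ?sl2_unit. Qed.
Fact sl2_mulgV : right_inverse sl2_one sl2_inv sl2_mul.
Proof. by move=> A; apply: val_inj; rewrite /= mulmxV ?sl2_unit. Qed.

HB.instance Definition _ :=
  isGroup.Build SL2 sl2_mulA sl2_mul1g sl2_mulg1 sl2_mulVg sl2_mulgV.

Definition eqpm (A B : SL2) : bool :=
  (A == B :> 'M_2) || (A == - (B : 'M_2) :> 'M_2).

Fact eqpm_refl : reflexive eqpm.
Proof. by move=> A; rewrite /eqpm eqxx. Qed.
Fact eqpm_sym : symmetric eqpm.
Proof. by move=> A B; rewrite /eqpm eq_sym (eq_sym (A : 'M_2)) eqr_oppLR. Qed.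
Fact eqpm_trans : transitive eqpm.
Proof.
move=> B A D; rewrite /eqpm => /orP[] /eqP -> // /orP[] /eqP ->.
  by rewrite eqxx orbT.
by rewrite opprK eqxx.
Qed.

Canonical eqpm_equiv := EquivRel eqpm eqpm_refl eqpm_sym eqpm_trans.

Definition PSL2 := {eq_quot eqpm}.
HB.instance Definition _ : EqQuotient _ eqpm PSL2 := EqQuotient.on PSL2.
HB.instance Definition _ := Choice.on PSL2.

Lemma eqpmP (A B : SL2) :
  reflect ((A : 'M_2) = B \/ (A : 'M_2) = - (B : 'M_2)) (A == B %[mod PSL2]).
Proof. by rewrite eqmodE; apply: (iffP orP) => -[] /eqP; [left|right|left|right]. Qed.

Definition psl2_one : PSL2 := lift_cst PSL2 sl2_one.
Definition psl2_mul := lift_op2 PSL2 sl2_mul.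
Definition psl2_inv := lift_op1 PSL2 sl2_inv.

Canonical pi_psl2_one := PiConst psl2_one.

Fact pi_psl2_mul : {morph \pi : A B / sl2_mul A B >-> psl2_mul A B}.
Proof.
move=> A B; unlock psl2_mul; apply/eqP/eqpmP => /=.
have /eqpmP := introT eqP (reprK (\pi_PSL2 A)).
have /eqpmP := introT eqP (reprK (\pi_PSL2 B)).
case=> -> [] ->; rewrite ?mulmxN ?mulNmx ?opprK; tauto.
Qed.
Canonical pi_psl2_mul_morph := PiMorph2 pi_psl2_mul.

Fact pi_psl2_inv : {morph \pi : A / sl2_inv A >-> psl2_inv A}.
Proof.
move=> A; unlock psl2_inv; apply/eqP/eqpmP => /=.
have /eqpmP := introT eqP (reprK (\pi_PSL2 A)).
case=> ->; first by left.
by rewrite -scaleN1r invmxZ ?unitmxZ ?unitrN1 ?sl2_unit // invrN1 scaleN1r opprK; right.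
Qed.
Canonical pi_psl2_inv_morph := PiMorph1 pi_psl2_inv.

Fact psl2_mulA : associative psl2_mul.
Proof. by elim/quotW=> A; elim/quotW=> B; elim/quotW=> D; rewrite !piE sl2_mulA. Qed.
Fact psl2_mul1g : left_id psl2_one psl2_mul.
Proof. by elim/quotW=> A; rewrite !piE sl2_mul1g. Qed.
Fact psl2_mulg1 : right_id psl2_one psl2_mul.
Proof. by elim/quotW=> A; rewrite !piE sl2_mulg1. Qed.
Fact psl2_mulVg : left_inverse psl2_one psl2_inv psl2_mul.
Proof. by elim/quotW=> A; rewrite !piE sl2_mulVg. Qed.
Fact psl2_mulgV : right_inverse psl2_one psl2_inv psl2_mul.
Proof. by elim/quotW=> A; rewrite !piE sl2_mulgV. Qed.

HB.instance Definition _ :=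
  isGroup.Build PSL2 psl2_mulA psl2_mul1g psl2_mulg1 psl2_mulVg psl2_mulgV.

Definition tr2 : PSL2 -> F := lift_fun1 PSL2 (fun A : SL2 => (\tr A) ^+ 2).

Fact pi_tr2 : {mono \pi : A / (\tr (A : SL2)) ^+ 2 >-> tr2 A}.
Proof.
move=> A; unlock tr2.
have /eqpmP := introT eqP (reprK (\pi_PSL2 A)).
by case=> -> //; rewrite raddfN sqrrN.
Qed.
Canonical pi_tr2_mono := PiMono1 pi_tr2.

End SL2.

Section Adjoint.
Variable C : numClosedFieldType.

Definition mx2 (a b c d : C) : 'M[C]_2 :=
  \matrix_(i, j) if i == 0 then if j == 0 then a else b
                 else if j == 0 then c else d.

(* The Pauli matrices: a basis of sl_2(C), orthonormal for the invariant form
   (X, Y) |-> tr (X Y) / 2. *)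
Definition pauli (k : 'I_3) : 'M[C]_2 :=
  tnth [tuple mx2 0 1 1 0; mx2 0 (- 'i) 'i 0; mx2 1 0 0 (- 1)] k.

(* Matrix of X |-> A X A^-1 on sl_2(C) in the Pauli basis; it lies in SO_3(C). *)
Definition sl2_adjoint (A : SL2 C) : 'M[C]_3 :=
  \matrix_(i, j) (\tr (pauli i *m (A *m pauli j *m invmx A)) / 2).

Lemma pauli_tr0 k : \tr (pauli k) = 0.
Proof.
by rewrite /mxtrace !big_ord_recl big_ord0 /pauli (tnth_nth 0);
   case: k => -[|[|[|//]]] ? /=; rewrite !mxE /= !addr0 ?subrr.
Qed.

Lemma pauli_coord (X : 'M[C]_2) :
  \tr X = 0 -> X = \sum_i (\tr (pauli i *m X) / 2) *: pauli i.
Proof.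
have i2 : 'i * 'i = -1 :> C by rewrite -expr2 sqrCi.
have n2 : 2 != 0 :> C by rewrite pnatr_eq0.
rewrite /mxtrace !big_ord_recl !big_ord0 addr0 => trX.
have X1 : X (lift ord0 ord0) (lift ord0 ord0) = - X ord0 ord0.
  by apply/eqP; rewrite -addr_eq0 addrC trX.
rewrite /pauli !(tnth_nth 0) /= !addr0.
apply/matrixP => i j; rewrite !mxE !big_ord_recl !big_ord0 !mxE /= !addr0.
case: (unliftP ord0 i) => [i'|] -> /=; [rewrite (ord1 i')|];
  (case: (unliftP ord0 j) => [j'|] -> /=; [rewrite (ord1 j')|]);
  by rewrite ?X1; field: i2.
Qed.

Lemma sl2_adjointE (A : SL2 C) j :
  A *m pauli j *m invmx A = \sum_i sl2_adjoint A i j *: pauli i.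
Proof.
rewrite [LHS]pauli_coord; first by apply: eq_bigr => i _; rewrite mxE.
by rewrite mxtrace_mulC mulmxA mulVmx ?sl2_unit // mul1mx pauli_tr0.
Qed.

Lemma sl2_adjoint1 : sl2_adjoint (sl2_one C) = 1%:M.
Proof.
have i2 : 'i * 'i = -1 :> C by rewrite -expr2 sqrCi.
have n2 : 2 != 0 :> C by rewrite pnatr_eq0.
apply/matrixP => i j; rewrite !mxE /= invmx1 mul1mx mulmx1.
rewrite /mxtrace !big_ord_recl !big_ord0 !mxE !big_ord_recl !big_ord0 /pauli.
rewrite !(tnth_nth 0); case: i => -[|[|[|//]]] ?; case: j => -[|[|[|//]]] ?;
  by rewrite /= !mxE /= /eq_op /=; field: i2.
Qed.

Lemma sl2_adjointM (A B : SL2 C) :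
  sl2_adjoint (sl2_mul A B) = sl2_adjoint A *m sl2_adjoint B.
Proof.
apply/matrixP => i j; rewrite !mxE /=.
have -> : invmx (A *m B : 'M_2) = invmx B *m invmx A.
  have uA := sl2_unit A; have uB := sl2_unit B.
  apply: (can_inj (mulKmx (_ : (A *m B : 'M_2) \in unitmx))).
    by rewrite unitmx_mul uA.
  by rewrite mulmxV ?unitmx_mul ?uA // !mulmxA mulmxK // mulmxV.
have -> : A *m B *m pauli j *m (invmx B *m invmx A)
        = A *m (B *m pauli j *m invmx B) *m invmx A by rewrite !mulmxA.
rewrite sl2_adjointE mulmx_sumr mulmx_suml mulmx_sumr raddf_sum mulr_suml.
apply: eq_bigr => k _; rewrite !mxE /= -scalemxAr -scalemxAl -scalemxAr mxtraceZ.
by rewrite -mulrA mulrC.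
Qed.

Lemma sl2_adjointV (A : SL2 C) : sl2_adjoint (sl2_inv A) = (sl2_adjoint A)^T.
Proof.
apply/matrixP => i j; rewrite !mxE /= invmxK; congr (_ / 2).
by rewrite -[_ *m pauli j *m _]mulmxA mulmxA mxtrace_mulC !mulmxA.
Qed.

Lemma sl2_adjoint_orth (A : SL2 C) :
  sl2_adjoint A *m (sl2_adjoint A)^T = 1%:M.
Proof. by rewrite -sl2_adjointV -sl2_adjointM sl2_mulgV sl2_adjoint1. Qed.

Definition adjoint : PSL2 C -> 'M[C]_3 := lift_fun1 (PSL2 C) sl2_adjoint.

Fact pi_adjoint : {mono \pi : A / sl2_adjoint A >-> adjoint A}.
Proof.
move=> A; unlock adjoint; apply/matrixP => i j; rewrite !mxE.
have /eqpmP := introT eqP (reprK (\pi_(PSL2 C) A)).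
case=> -> //; rewrite -scaleN1r invmxZ ?unitmxZ ?unitrN1 ?sl2_unit // invrN1.
by rewrite !scaleN1r !mulNmx !mulmxN opprK.
Qed.
Canonical pi_adjoint_mono := PiMono1 pi_adjoint.

End Adjoint.

(* Regular functions on a set Y embedded in affine space C^n by e: the
   restrictions of the polynomial functions. *)
Definition regular (C : fieldType) (Y : Type) (n : nat) (e : Y -> 'I_n -> C) :
    set (Y -> C) :=
  [set f | exists p : {mpoly C[n]}, forall y, f y = p.@[e y]].

Definition algebraic_set (C : fieldType) (n : nat) (X : set ('I_n -> C)) : Prop :=
  exists S : set {mpoly C[n]}, X = [set x | forall p, S p -> p.@[x] = 0].

Definition generates (G : groupType) (s : nat) (g : 'I_s -> G) : Prop :=
  forall H : {pred G}, group_closed H -> (forall i, g i \in H) ->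
  forall x, x \in H.

Section Representations.
Variables (C : numClosedFieldType) (G : groupType).
Local Open Scope group_scope.

Definition rep : Type := UMagmaMorphism.type G (PSL2 C).

Definition conj_fun (P : PSL2 C) (rho : rep) : G -> PSL2 C :=
  fun x => P * rho x * P^-1.

Fact conj_monoid_morphism P rho : monoid.monoid_morphism (conj_fun P rho).
Proof.
split=> [|x y]; first by rewrite /conj_fun gmulf1 mulg1 mulgV.
by rewrite /conj_fun gmulfM !mulgA mulgVK.
Qed.

HB.instance Definition _ P rho :=
  isUMagmaMorphism.Build G (PSL2 C) (conj_fun P rho)
    (conj_monoid_morphism P rho).

Definition conj_rep (P : PSL2 C) (rho : rep) : rep := conj_fun P rho.

Definition character (rho : rep) : G -> C := fun x => tr2 (rho x).

(* Affine coordinates on the representation variety: the entries of the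
   adjoint matrices of the images of the generators. *)
Definition rep_coord (s : nat) (g : 'I_s -> G) (rho : rep) :
    'I_#|{: 'I_s * 'I_3 * 'I_3}| -> C :=
  fun k => let: (l, i, j) := enum_val k in adjoint (rho (g l)) i j.

Definition invariant : set (rep -> C) :=
  [set f | forall P rho, f (conj_rep P rho) = f rho].

(* (X, t) is the quotient R(G) // PSL2(C).  As f |-> f \o t is always a morphism
   of algebras, it is an isomorphism C[X] -> C[R(G)]^PSL2(C) iff it is a
   bijection between these sets of functions. *)
Record is_GIT_quotient (s : nat) (g : 'I_s -> G) (m : nat)
    (X : set ('I_m -> C)) (t : rep -> X) : Prop := {
  git_algebraic : algebraic_set X;
  git_regular : forall i, regular (rep_coord g) (fun rho => val (t rho) i);
  git_iso : set_bij (regular (val : X -> 'I_m -> C))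
                    (regular (rep_coord g) `&` invariant)
                    (fun f => f \o t)
}.

End Representations.

(* Main.v *)
(* Averaging over conjugation by SU(2) gives a Reynolds operator on C[R(G)]. It
   is realized as a finite weighted sum over points of SL_2(C), exact on
   polynomials of bounded degree, so that it is visibly defined on functions on
   R(G) and linear over the invariants. Haar integration of polynomials satisfies
   Wick's formula; as in the first fundamental theorem for SL_2 = Sp_2, the
   average of a product of matrix entries of lifts to SL_2 is therefore a sum of
   products of traces of words, in which each generator occurs an even number of
   times. Such products are determined by the squares of the traces, since
   tr u tr v = tr uv + tr uv^-1 and even words are products of squares, whose
   traces reduce to those of u^2 v^2 and u^2 v^2 w^2. Hence an invariant function
   takes equal values on representations with equal characters; conversely
   characters are invariant regular functions. Surjectivity of t follows as usual
   from the Nullstellensatz and the Reynolds operator. *)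
Require Import Defs.
From HB Require Import structures.
From mathcomp Require Import mpoly.
From mathcomp Require Import all_boot all_order all_algebra.
From mathcomp Require Import boolp classical_sets functions reals.
From mathcomp Require Import complex ring.

Set Implicit Arguments.
Unset Strict Implicit.
Unset Printing Implicit Defensive.

Import Order.TTheory GRing.Theory Num.Theory.

(** Two obstacles shape the proof. A representation need not lift to SL_2, only the images of the
    generators do, so the sign of the trace of a word carries no meaning. Evenness in every
    generator removes the ambiguity, and it is automatic for adjoint entries, which involve each
    lift once directly and once inverted. Moreover, the average is a weighted sum over points, whose
    invariance is not visible. It is read off from Wick's formula: the averaged function depends on
    the character alone, and characters are invariant. *)

(* Entries must be abstracted first: [ring] is slow to tell [A 0 0] from [A 0 1]. *)
Ltac entries A :=
  move: (A 0%R 0%R) (A 0%R 1%R) (A 1%R 0%R) (A 1%R 1%R) => ? ? ? ?.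

(** * Traces of words in SL_2 *)

Section TwoByTwo.
Local Open Scope ring_scope.

Lemma sum_ord2 (V : nmodType) (F : 'I_2 -> V) : \sum_i F i = F 0 + F 1.
Proof. by rewrite !big_ord_recl big_ord0 addr0; congr (_ + F _); apply: val_inj. Qed.

Lemma ord2P (i : 'I_2) : (i = 0) \/ (i = 1).
Proof. by case: i => -[|[|//]] p; [left|right]; apply: val_inj. Qed.

Variable R : comNzRingType.
Implicit Types A B : 'M[R]_2.

Lemma mulmx2E m n (A : 'M[R]_(m, 2)) (B : 'M[R]_(2, n)) i j :
  (A *m B) i j = A i 0 * B 0 j + A i 1 * B 1 j.
Proof. by rewrite mxE sum_ord2. Qed.

Lemma mxtrace2E A : \tr A = A 0 0 + A 1 1.
Proof. exact: sum_ord2. Qed.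

Lemma lift_ord2 : ((lift 0 0 = 1 :> 'I_2) * (lift 1 0 = 0 :> 'I_2))%type.
Proof. by split; apply: val_inj. Qed.

Lemma det2E A : \det A = A 0 0 * A 1 1 - A 0 1 * A 1 0.
Proof.
rewrite (expand_det_row _ 0) sum_ord2 /cofactor !det_mx11 !mxE /= !lift_ord2.
by rewrite expr0 expr1 mul1r mulN1r mulrN.
Qed.

Lemma matrix2P A B : A 0 0 = B 0 0 -> A 0 1 = B 0 1 -> A 1 0 = B 1 0 ->
  A 1 1 = B 1 1 -> A = B.
Proof.
by move=> *; apply/matrixP => i j; case: (ord2P i) (ord2P j) => -> [] ->.
Qed.

(** Polarized Cayley-Hamilton, the fundamental trace identity of 2 x 2 matrices; it fixes the
    symmetric part tr uvw + tr uwv of a triple trace. *)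
Lemma mxtrace2_polarized A B D :
  \tr (A *m B *m D) + \tr (A *m D *m B) =
  \tr A * \tr (B *m D) + \tr B * \tr (A *m D) + \tr D * \tr (A *m B)
  - \tr A * \tr B * \tr D.
Proof. rewrite !mxtrace2E !mulmx2E; entries A; entries B; entries D; ring. Qed.

(* The vector and scalar parts of a product of three vectors in the Clifford
   algebra M_2. *)
Lemma mulmx2_traceless3 A B D : \tr A = 0 -> \tr B = 0 -> \tr D = 0 ->
  (A *m B *m D) *+ 2 = \tr (B *m D) *: A - \tr (A *m D) *: B
     + \tr (A *m B) *: D + (\tr (A *m B *m D))%:M.
Proof.
have tr0 (E : 'M[R]_2) : \tr E = 0 -> E 1 1 = - E 0 0.
  by rewrite mxtrace2E addrC => /eqP; rewrite addr_eq0 => /eqP.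
move=> /tr0 a /tr0 b /tr0 d.
by apply: matrix2P; rewrite mulr2n !(mxtrace2E, mulmx2E, mxE) ?a ?b ?d
  /= ?mulr1n ?mulr0n; entries A; entries B; entries D; ring.
Qed.

Lemma mxtrace2_traceless3 A B D E : \tr A = 0 -> \tr B = 0 -> \tr D = 0 ->
  \tr (A *m (B *m (D *m E))) *+ 2 =
  \tr (B *m D) * \tr (A *m E) - \tr (A *m D) * \tr (B *m E)
  + \tr (A *m B) * \tr (D *m E) + \tr (A *m B *m D) * \tr E.
Proof.
move=> a b d; rewrite !mulmxA mulr2n -mxtraceD -mulmxDl -mulr2n mulmx2_traceless3 //.
rewrite 2!mulmxDl mulmxBl -!scalemxAl mul_scalar_mx.
by rewrite !mxtraceD [\tr (- _)]raddfN /= !mxtraceZ.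
Qed.

End TwoByTwo.

Section SL2Trace.
Local Open Scope ring_scope.
Variable F : fieldType.
Implicit Types A B D : SL2 F.

Lemma sl2_det_entries A : A 0 0 * A 1 1 - A 0 1 * A 1 0 = 1.
Proof. by rewrite -det2E (eqP (sl2_det A)). Qed.

Lemma sl2_valM A B : (A * B)%g = A *m B :> 'M_2. Proof. by []. Qed.

Lemma sl2_valV A : (A^-1)%g = \adj (A : 'M_2) :> 'M_2.
Proof. by rewrite /= /invmx sl2_unit (eqP (sl2_det A)) invr1 scale1r. Qed.

Lemma adj2E (R : comNzRingType) (A : 'M[R]_2) :
  [/\ (\adj A) 0 0 = A 1 1, (\adj A) 0 1 = - A 0 1,
      (\adj A) 1 0 = - A 1 0 & (\adj A) 1 1 = A 0 0].
Proof.
rewrite !mxE /cofactor !det_mx11 !mxE /= !lift_ord2 /=.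
by rewrite ?addn0 ?add0n sqrrN expr1n expr1 expr0 !mul1r !mulN1r.
Qed.

Lemma mxtrace_sl2V A : \tr (A^-1)%g = \tr A.
Proof. by rewrite sl2_valV !mxtrace2E; case: (adj2E A) => -> _ _ ->; rewrite addrC. Qed.

Lemma mxtrace_sl2M A B : \tr A * \tr B = \tr (A * B)%g + \tr (A * B^-1)%g.
Proof.
rewrite !sl2_valM sl2_valV !mxtrace2E !mulmx2E; case: (adj2E B) => -> -> -> ->.
entries A; entries B; ring.
Qed.

Lemma sl2_sqr A : (A * A)%g = \tr A *: (A : 'M_2) - 1%:M :> 'M_2.
Proof.
have := sl2_det_entries A; rewrite sl2_valM mxtrace2E => dA.
by apply: matrix2P; rewrite !mulmx2E !mxE /= ?mulr1n ?mulr0n -?dA;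
  entries (A : 'M_2); ring.
Qed.

End SL2Trace.

Section TracelessFamilies.
Local Open Scope ring_scope.

(** Longer products reduce by [mxtrace2_traceless3], which leaves only pairs, one triple and shorter
    products; its factor 2 cancels in characteristic 0. *)
Lemma mxtrace_prod_traceless_eq (C : numFieldType) (T : Type) (Z Z' : T -> 'M[C]_2) :
    (forall u, \tr (Z u) = 0) -> (forall u, \tr (Z' u) = 0) ->
    (forall u v, \tr (Z u *m Z v) = \tr (Z' u *m Z' v)) ->
    (forall u v w, \tr (Z u *m Z v *m Z w) = \tr (Z' u *m Z' v *m Z' w)) ->
  forall us, \tr (foldr (fun u => mulmx (Z u)) 1%:M us)
           = \tr (foldr (fun u => mulmx (Z' u)) 1%:M us).
Proof.
move=> Z0 Z0' ZZ ZZZ us; have [n] := ubnP (size us).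
elim: n us => // n IH us /ltnSE.
case: us => [|u [|v [|w us]]] le_us //=; first by rewrite !mulmx1 Z0 Z0'.
  by rewrite !mulmx1 ZZ.
apply: (pmulrnI (isT : 0 < 2)%N).
rewrite /= !mxtrace2_traceless3 // !ZZ ZZZ.
have le3 a : (size (a :: us) < n)%N by apply: ltnW.
by rewrite (IH _ (le3 u)) (IH _ (le3 v)) (IH _ (le3 w)) (IH us (ltnW (le3 u))).
Qed.

End TracelessFamilies.

(** * Words in the generators and their inverses *)

Section Words.
Variable s : nat.
Local Open Scope group_scope.

(* The letters [(i, true)] and [(i, false)] stand for the [i]-th generator and
   its inverse. *)
Definition word := seq ('I_s * bool).
Implicit Types u v w : word.

Definition winv w : word := rev [seq (l.1, ~~ l.2) | l <- w].

Definition wletter i w := count (fun l => l.1 == i) w.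

Lemma wletter_cat i u v : wletter i (u ++ v) = (wletter i u + wletter i v)%N.
Proof. exact: count_cat. Qed.

Lemma wletter_inv i w : wletter i (winv w) = wletter i w.
Proof. by rewrite /wletter /winv count_rev count_map; apply: eq_count. Qed.

Definition wletterE := (wletter_cat, wletter_inv).

Section Value.
Variables (G : groupType) (x : 'I_s -> G).

Definition wval w : G :=
  foldr (fun l a => (if l.2 then x l.1 else (x l.1)^-1) * a) 1 w.

Lemma wval_cat u v : wval (u ++ v) = wval u * wval v.
Proof. by elim: u => [|l u IH] /=; rewrite ?mul1g // IH mulgA. Qed.

Lemma wval_inv w : wval (winv w) = (wval w)^-1.
Proof.
elim: w => [|[i b] w IH] /=; first by rewrite invg1.
rewrite /winv map_cons rev_cons -cats1 -/(winv w) wval_cat IH /= mulg1 invgM.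
by case: b; rewrite /= ?invgK.
Qed.

Lemma wval_generates : generates x -> forall a, exists w, wval w = a.
Proof.
move=> gen a.
suff /asboolP : a \in (fun b => `[< exists w, wval w = b >] : bool) by [].
apply: gen => [|i]; last by apply/asboolP; exists [:: (i, true)]; rewrite /= mulg1.
split=> [|b c]; first by apply/asboolP; exists [::].
move=> /asboolP[u <-] /asboolP[v <-]; apply/asboolP.
by exists (u ++ winv v); rewrite wval_cat wval_inv.
Qed.

End Value.

Lemma wval_morph (G H : groupType) (f : G -> H) (x : 'I_s -> G) w :
  {morph f : a b / a * b} -> wval (f \o x) w = f (wval x w).
Proof.
move=> fM.
have f1 : f 1 = 1 by apply: (mulgI (f 1)); rewrite -fM !mulg1.
have fV a : f a^-1 = (f a)^-1.
  by apply/esym/mulg1_eq; rewrite -fM mulgV f1.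
by elim: w => [|[i b] w /= ->] //=; rewrite fM; case: b; rewrite /= ?fV.
Qed.

End Words.

Section EvenWords.
Variables (s : nat).
Local Open Scope group_scope.

(* Modulo squares and the order of the factors, equal letters cancel:
   [x w x w' = (x w)^2 w^-1 w'] and [x w x^-1 w' = (x w)^2 (w^-1 x^-1 w)^2 w^-1 w']. *)
Lemma even_word_squares (w : word s) : (forall i, ~~ odd (wletter i w)) ->
  exists us : seq (word s), forall (G : groupType) (x : 'I_s -> G),
    wval x w = foldr (fun u a => wval x u * wval x u * a) 1 us.
Proof.
have [n] := ubnP (size w); elim: n w => // n IH [|[i b] w] /ltnSE le_wn ev.
  by exists [::].
have /hasP[[j b'] ljw /eqP /= eji] : has (fun l => l.1 == i) w.
  by rewrite has_count; have := ev i; rewrite /wletter /= eqxx add1n /= negbK => /odd_gt0.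
subst j; case/splitPr: ljw ev le_wn => u v ev le_uv.
have [|k|us usP] := IH (winv u ++ v).
- by move: le_uv; rewrite /= !size_cat size_rev size_map /= addnS; move/ltnW.
- have := ev k; rewrite !wletterE /wletter /= count_cat /=.
  by case: (i == k); rewrite /= ?add0n ?addnS //= negbK.
pose a : word s := [:: (i, b)].
exists ((a ++ u) :: if b == b' then us else (winv u ++ winv a ++ u) :: us) => G x.
rewrite -[LHS]/(wval x ((i, b) :: u ++ (i, b') :: v)).
have -> : (i, b) :: u ++ (i, b') :: v
        = a ++ u ++ (if b == b' then a else winv a) ++ v.
  by rewrite {}/a; case: (b) (b') => -[].
clearbody a; have usE := usP G x; rewrite wval_cat wval_inv in usE.
case: (b == b') => /=; rewrite -usE !wval_cat ?wval_inv; first by rewrite !mulgA mulgK.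
by rewrite !mulgA !mulgK.
Qed.

End EvenWords.

(** * Even products of traces are determined by squared traces *)

Section TraceAgreement.
Local Open Scope ring_scope.
Variables (C : numFieldType) (s : nat) (x y : 'I_s -> SL2 C).
Implicit Types u v w : word s.
Local Notation T z w := (\tr (wval z w : 'M[C]_2)).
Hypothesis sqr_agree : forall w, T x w ^+ 2 = T y w ^+ 2.

Lemma trace_cat_inv (z : 'I_s -> SL2 C) u v :
  T z (u ++ winv v) = T z u * T z v - T z (u ++ v).
Proof.
by rewrite !wval_cat wval_inv mxtrace_sl2M addrAC subrr add0r.
Qed.

Lemma trace_inv (z : 'I_s -> SL2 C) u : T z (winv u) = T z u.
Proof. by rewrite wval_inv mxtrace_sl2V. Qed.

Lemma trace_rot (z : 'I_s -> SL2 C) u v : T z (u ++ v) = T z (v ++ u).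
Proof. by rewrite !wval_cat !sl2_valM mxtrace_mulC. Qed.

(** Squaring tr uv^-1 = tr u tr v - tr uv isolates the mixed product. *)
Lemma trace_agree3 u v :
  T x u * T x v * T x (u ++ v) = T y u * T y v * T y (u ++ v).
Proof.
have E (z : 'I_s -> SL2 C) : T z u * T z v * T z (u ++ v) =
    (T z u ^+ 2 * T z v ^+ 2 + T z (u ++ v) ^+ 2 - T z (u ++ winv v) ^+ 2) / 2.
  by rewrite trace_cat_inv; field.
by rewrite !E !sqr_agree.
Qed.

(** Put t = tr uvw, t' = tr uwv, and let c run over tr u tr vw, tr v tr uw, tr w tr uv. The eight
    squares are t^2, t'^2, (c - t)^2 and (c - t')^2. Their alternating sum is 2 (t - t') (sum of the
    c - t - t'), and the last factor is tr u tr v tr w by [mxtrace2_polarized]. The same identity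
    gives t + t', whence t times tr u tr v tr w. *)
Lemma trace_agree4 u v w :
  T x u * T x v * T x w * T x (u ++ v ++ w)
  = T y u * T y v * T y w * T y (u ++ v ++ w).
Proof.
have E (z : 'I_s -> SL2 C) : T z u * T z v * T z w * T z (u ++ v ++ w) =
   (2 * (T z u ^+ 2 * (T z v * T z w * T z (v ++ w))
       + T z v ^+ 2 * (T z u * T z w * T z (u ++ w))
       + T z w ^+ 2 * (T z u * T z v * T z (u ++ v))
       - T z u ^+ 2 * T z v ^+ 2 * T z w ^+ 2)
   + (T z (u ++ v ++ w) ^+ 2 - T z (v ++ w ++ winv u) ^+ 2
      - T z (w ++ u ++ winv v) ^+ 2 - T z (u ++ v ++ winv w) ^+ 2
      + T z (w ++ winv (v ++ u)) ^+ 2 + T z (v ++ winv (u ++ w)) ^+ 2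
      + T z (u ++ winv (w ++ v)) ^+ 2 - T z (winv (u ++ w ++ v)) ^+ 2)) / 4.
  have b1 : T z (w ++ v ++ u) = T z (u ++ w ++ v) by rewrite catA trace_rot.
  have b2 : T z (v ++ u ++ w) = T z (u ++ w ++ v) by rewrite trace_rot catA.
  have a1 : T z (v ++ w ++ u) = T z (u ++ v ++ w) by rewrite catA trace_rot.
  have a2 : T z (w ++ u ++ v) = T z (u ++ v ++ w) by rewrite trace_rot catA.
  have S : T z (u ++ v ++ w) + T z (u ++ w ++ v) = T z u * T z (v ++ w)
     + T z v * T z (u ++ w) + T z w * T z (u ++ v) - T z u * T z v * T z w.
    by rewrite !wval_cat !sl2_valM !mulmxA mxtrace2_polarized.
  rewrite [v ++ w ++ winv u]catA [w ++ u ++ winv v]catA [u ++ v ++ winv w]catA.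
  rewrite !trace_cat_inv trace_inv -!catA a1 a2 b1 b2.
  rewrite [T z (w ++ u)]trace_rot [T z (v ++ u)]trace_rot [T z (w ++ v)]trace_rot.
  move: S => /(canRL (addKr _)) ->.
  by field.
by rewrite !E !trace_agree3 !sqr_agree.
Qed.

(* [2 Y], where [Y = (tr A / 2) (A - tr A / 2)] is dual to the antisymmetric part of [Ad A]. *)
Definition sqr_traceless (A : SL2 C) : 'M[C]_2 :=
  \tr A *: (A : 'M_2) - (\tr A ^+ 2 / 2)%:M.

Lemma mxtrace_sqr_traceless (A : SL2 C) : \tr (sqr_traceless A) = 0.
Proof. by rewrite /sqr_traceless raddfB /= mxtraceZ mxtrace_scalar; field. Qed.

Lemma sqr_tracelessE (A : SL2 C) :
  (A * A)%g = (\tr A ^+ 2 / 2 - 1)%:M + sqr_traceless A :> 'M_2.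
Proof. by rewrite sl2_sqr /sqr_traceless raddfB /= [RHS]addrC addrA subrK. Qed.

Let Z z u := sqr_traceless (wval z u).

Lemma sqr_traceless_agree2 u v :
  \tr (Z x u *m Z x v) = \tr (Z y u *m Z y v).
Proof.
have E z : \tr (Z z u *m Z z v) = T z u * T z v * T z (u ++ v)
    - T z u ^+ 2 * T z v ^+ 2 / 2.
  rewrite /Z /sqr_traceless wval_cat sl2_valM !mulmxBl !mulmxBr -!scalemxAl -!scalemxAr.
  rewrite !mul_scalar_mx !mul_mx_scalar !raddfB /= !mxtraceZ mxtrace_scalar.
  by field.
by rewrite !E trace_agree3 !sqr_agree.
Qed.

Lemma sqr_traceless_agree3 u v w :
  \tr (Z x u *m Z x v *m Z x w) = \tr (Z y u *m Z y v *m Z y w).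
Proof.
have E z : \tr (Z z u *m Z z v *m Z z w) =
    T z u * T z v * T z w * T z (u ++ v ++ w)
    - (T z u ^+ 2 * (T z v * T z w * T z (v ++ w))
       + T z v ^+ 2 * (T z u * T z w * T z (u ++ w))
       + T z w ^+ 2 * (T z u * T z v * T z (u ++ v))) / 2
    + T z u ^+ 2 * T z v ^+ 2 * T z w ^+ 2 / 2.
  rewrite /Z /sqr_traceless !wval_cat !sl2_valM !mulmxA.
  rewrite !mxtrace2E !(mulmx2E, mxE) /= !mulr1n !mulr0n.
  entries (wval z u : 'M_2); entries (wval z v : 'M_2); entries (wval z w : 'M_2).
  by field.
by rewrite !E trace_agree4 !trace_agree3 !sqr_agree.
Qed.

Lemma prod_sqr_traceless_agree us :
  \tr (foldr (fun u => mulmx (Z x u)) 1%:M us)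
  = \tr (foldr (fun u => mulmx (Z y u)) 1%:M us).
Proof.
apply: mxtrace_prod_traceless_eq => *; do ?exact: mxtrace_sqr_traceless.
  exact: sqr_traceless_agree2.
exact: sqr_traceless_agree3.
Qed.

(** Each square is a scalar determined by the squared trace, plus a traceless part. The product is
    expanded factor by factor; [vs] lists the factors where the traceless part was taken. *)
Lemma prod_sqr_agree us :
  \tr (foldr (fun u a => wval x u * wval x u * a) 1 us)%g
  = \tr (foldr (fun u a => wval y u * wval y u * a) 1 us)%g.
Proof.
pose P z vs (A : 'M[C]_2) := foldr (fun u (B : 'M_2) => Z z u *m B) A vs.
suff H vs : \tr (P x vs (foldr (fun u a => wval x u * wval x u * a) 1 us)%g)
          = \tr (P y vs (foldr (fun u a => wval y u * wval y u * a) 1 us)%g).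
  exact: H [::].
elim: us vs => [|u us IH] vs; first exact: prod_sqr_traceless_agree.
have E z (A : SL2 C) : \tr (P z vs (wval z u * wval z u * A)%g) =
    (T z u ^+ 2 / 2 - 1) * \tr (P z vs A) + \tr (P z (rcons vs u) A).
  rewrite sl2_valM sqr_tracelessE mulmxDl mul_scalar_mx /P foldr_rcons.
  rewrite -mxtraceZ -raddfD /=; congr (\tr _).
  by elim: vs {IH} => [|v vs IH] //=; rewrite IH mulmxDr -scalemxAr.
by rewrite /= !E !IH sqr_agree.
Qed.

Lemma even_trace_agree (ws : seq (word s)) :
  (forall i, ~~ odd (wletter i (flatten ws))) ->
  \prod_(w <- ws) T x w = \prod_(w <- ws) T y w.
Proof.
have [n] := ubnP (size ws).
elim: n ws => // n IH [|u [|v ws]] /ltnSE le_ws ev; first by rewrite !big_nil.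
  rewrite /= cats0 in ev; rewrite !big_seq1.
  by have [us usP] := even_word_squares ev; rewrite !usP prod_sqr_agree.
have E (z : 'I_s -> SL2 C) : \prod_(w <- [:: u, v & ws]) T z w = \prod_(w <- (u ++ v) :: ws) T z w
    + \prod_(w <- (u ++ winv v) :: ws) T z w.
  by rewrite !big_cons mulrA -mulrDl trace_cat_inv addrC subrK.
by rewrite !E !IH //= => i; have := ev i; rewrite /= !wletterE // addnA.
Qed.

End TraceAgreement.

(** * Integration over SU(2) *)

Section Cubature.
Local Open Scope ring_scope.
Variable C : numFieldType.

(** Distinct nodes realize any prescribed moments. They start at 1 because they later serve as
    invertible coordinates. *)
Lemma vandermonde_weights n (m : nat -> C) : exists w : 'I_n -> C,
  forall k, (k < n)%N -> \sum_j w j * j.+1%:R ^+ k = m k.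
Proof.
pose a : 'rV[C]_n := \row_j j.+1%:R.
have uV : Vandermonde n a \in unitmx.
  rewrite unitmxE det_Vandermonde unitfE; apply/prodf_neq0 => i _.
  apply/prodf_neq0 => j lt_ij.
  by rewrite !mxE subr_eq0 eqr_nat eqSS gtn_eqF.
exists (fun j => (invmx (Vandermonde n a) *m \col_i m i) j 0) => k lt_kn.
have /matrixP/(_ (Ordinal lt_kn) 0) := mulKVmx uV (\col_i m i).
rewrite !mxE => <-; apply: eq_bigr => j _; rewrite mulrC.
by rewrite [Vandermonde _ _ _ _]mxE [a _ _]mxE.
Qed.

(* [\int_0^1 x^i (x - 1)^j dx] *)
Definition beta i j : C := (-1) ^+ j * (i`! * j`!)%:R / (i + j).+1`!%:R.

Let fact_nz n : n`!%:R != 0 :> C.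
Proof. by rewrite pnatr_eq0 -lt0n fact_gt0. Qed.

Let natS_nz n : n.+1%:R != 0 :> C. Proof. by rewrite pnatr_eq0. Qed.

Lemma beta_i0 i : beta i 0 = i.+1%:R^-1.
Proof.
rewrite /beta addn0 muln1 expr0 mul1r factS natrM invfM mulrCA divff ?mulr1 //.
Qed.

Lemma betaSl i j : beta i.+1 j = i.+1%:R / (i + j).+2%:R * beta i j.
Proof.
rewrite /beta addSn (factS i) (factS (i + j).+1) !natrM invfM.
by rewrite mulrCA !mulrA; ring.
Qed.

Lemma betaSr i j : beta i j.+1 = - j.+1%:R / (i + j).+2%:R * beta i j.
Proof.
rewrite /beta addnS (factS j) (factS (i + j).+1) !natrM invfM exprS.
ring.
Qed.

Lemma beta_rec i j : beta i j.+1 = beta i.+1 j - beta i j.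
Proof.
rewrite betaSr betaSl -[X in _ - X]mul1r -mulrBl; congr (_ * _).
apply: (mulIf (natS_nz (i + j).+1)); rewrite mulrBl !mulfVK ?natS_nz //.
have -> : (i + j).+2 = (i.+1 + j.+1)%N by rewrite addSn addnS.
by rewrite mul1r natrD opprD addrA subrr sub0r.
Qed.

Lemma beta_weights N : exists w : 'I_N -> C,
  forall i j, (i + j < N)%N -> \sum_k w k * (k.+1%:R ^+ i * (k.+1%:R - 1) ^+ j) = beta i j.
Proof.
have [w wP] := vandermonde_weights N (fun k => k.+1%:R^-1).
exists w => i j; elim: j i => [|j IH] i lt_ij.
  rewrite addn0 in lt_ij; rewrite beta_i0 -wP //.
  by apply: eq_bigr => k _; rewrite expr0 mulr1.
have lt1 : (i.+1 + j < N)%N by rewrite addSn -addnS.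
have lt2 : (i + j < N)%N by apply: ltn_trans lt1; rewrite addSn.
rewrite beta_rec -(IH _ lt1) -(IH _ lt2).
rewrite -sumrB; apply: eq_bigr => k _; rewrite -mulrBr !exprS; congr (_ * _); ring.
Qed.

(** Plays the role of averaging over a circle: it extracts the constant term of a Laurent monomial.
    Multiplying by the N-th power makes all exponents nonnegative, so the constant term becomes the
    moment of order N. *)
Lemma coef_weights N : exists w : 'I_(N + N).+1 -> C,
  forall i l, (i <= N)%N -> (l <= N)%N ->
    \sum_k w k * (k.+1%:R ^+ i * k.+1%:R ^- l) = (i == l)%:R.
Proof.
have [w wP] := vandermonde_weights (N + N).+1 (fun k => (k == N)%:R).
exists (fun k => w k * k.+1%:R ^+ N) => i l le_iN le_lN.
rewrite -(eqn_add2r (N - l)) subnKC // -wP; last first.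
  by rewrite ltnS leq_add ?leq_subr.
apply: eq_bigr => k _; rewrite -mulrA; congr (_ * _).
by rewrite mulrCA exprD exprB ?unitfE ?natS_nz.
Qed.

(** Coordinates on the part of SL_2 where a and c are nonzero: a = u, c = 1/v, ad = x, hence bc = x
    - 1. *)
Definition torus_node_mx (u v x : C) : 'M[C]_2 :=
  \matrix_(i, j) if i == 0 then if j == 0 then u else v * (x - 1)
                 else if j == 0 then v^-1 else x / u.

Fact torus_node_det (i j k : nat) :
  \det (torus_node_mx i.+1%:R j.+1%:R k.+1%:R) == 1.
Proof.
rewrite det2E !mxE /=; apply/eqP.
move: (natS_nz i) (natS_nz j); move: i.+1%:R j.+1%:R k.+1%:R => u v x u0 v0.
by field; rewrite u0 v0.
Qed.

Definition torus_node i j k := MkSL2 (torus_node_det i j k).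

(* Haar integration over SU(2): averaging the nodes over the two torus
   coordinates [u] and [v] keeps the monomials in [a d = x] and [b c = x - 1],
   on which the Haar measure is [dx] on [[0, 1]]. *)
Lemma sl2_cubature N : exists S : seq (C * SL2 C), forall i j k l,
    (i <= N)%N -> (j <= N)%N -> (k <= N)%N -> (l <= N)%N ->
  \sum_(q <- S) q.1 * (q.2 0 0 ^+ i * q.2 0 1 ^+ j * q.2 1 0 ^+ k * q.2 1 1 ^+ l)
  = if (i == l) && (j == k) then beta i j else 0.
Proof.
have [w wP] := coef_weights N; have [b bP] := beta_weights (N + N).+1.
exists [seq (w p.1.1 * w p.1.2 * b p.2, torus_node p.1.1 p.1.2 p.2)
       | p <- enum {: 'I_(N + N).+1 * 'I_(N + N).+1 * 'I_(N + N).+1}].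
move=> i j k l iN jN kN lN; rewrite big_map big_enum /=.
transitivity ((i == l)%:R * (j == k)%:R * beta l j); last first.
  by case: eqVneq => [->|_]; case: eqVneq => _; rewrite ?mul1r ?mul0r.
rewrite -(wP _ _ iN lN) -(wP _ _ jN kN) -bP ?ltnS ?leq_add //.
rewrite big_distrlr /= pair_bigA big_distrlr /= pair_bigA /=.
apply: eq_bigr => -[[p q] r] _ /=; rewrite !mxE /= !exprMn !exprVn.
move: (p.+1%:R ^+ i) => A; move: (_ ^- l) => B; move: (_ ^+ j) => D; ring.
Qed.

End Cubature.

(* Haar integration satisfies Wick's formula, with propagator
   [<x_(i,a), x_(j,b)> = E i j * E a b] for [E = skew2] below. *)
Section Wick.
Local Open Scope ring_scope.
Variable C : numFieldType.
Implicit Types (i j k a b c : 'I_2) (p f : {mpoly C[2 * 2]}).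

Definition vidx i a : 'I_(2 * 2) := mxvec_index i a.

Definition coord i a : {mpoly C[2 * 2]} := 'X_(vidx i a).

Lemma vidx_eq i a j b : (vidx i a == vidx j b) = (i == j) && (a == b).
Proof.
apply/eqP/andP => [|[/eqP-> /eqP->] //].
by move=> /cast_ord_inj /enum_rank_inj [-> ->].
Qed.

Lemma big_vidx (V : Type) (idx : V) (op : Monoid.com_law idx) (F : 'I_(2 * 2) -> V) :
  \big[op/idx]_k F k =
  op (op (op (F (vidx 0 0)) (F (vidx 0 1))) (F (vidx 1 0))) (F (vidx 1 1)).
Proof.
rewrite (reindex (uncurry vidx)) /=; last exact: curry_mxvec_bij.
transitivity (\big[op/idx]_(p : 'I_2 * 'I_2) F (vidx p.1 p.2)).
  by apply: eq_bigr => -[].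
rewrite -(pair_bigA _ (fun i a => F (vidx i a))) /=.
by rewrite !big_ord_recl !big_ord0 !Monoid.mulm1 !lift_ord2 !Monoid.mulmA.
Qed.

Variable S : seq (C * SL2 C).

Definition mean p := \sum_(q <- S) q.1 * p.@[mxvec (q.2 : 'M_2) 0].

Lemma meanD p f : mean (p + f) = mean p + mean f.
Proof. by rewrite -big_split; apply: eq_bigr => q _; rewrite mevalD mulrDr. Qed.

Lemma meanZ x p : mean (x *: p) = x * mean p.
Proof. by rewrite big_distrr; apply: eq_bigr => q _; rewrite mevalZ mulrCA. Qed.

Lemma mean0 : mean 0 = 0.
Proof. by rewrite -[0 in LHS](scale0r 0) meanZ mul0r. Qed.

Lemma meanB p f : mean (p - f) = mean p - mean f.
Proof. by rewrite meanD -scaleN1r meanZ mulN1r. Qed.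

Lemma mean_sum (I : Type) (r : seq I) (P : pred I) (F : I -> {mpoly C[2 * 2]}) :
  mean (\sum_(i <- r | P i) F i) = \sum_(i <- r | P i) mean (F i).
Proof. exact: (big_morph mean meanD mean0). Qed.

Definition cubature N := forall i j k l : nat,
    (i <= N)%N -> (j <= N)%N -> (k <= N)%N -> (l <= N)%N ->
  \sum_(q <- S) q.1 * (q.2 0 0 ^+ i * q.2 0 1 ^+ j * q.2 1 0 ^+ k * q.2 1 1 ^+ l)
  = if (i == l) && (j == k) then beta C i j else 0.

Variable N : nat.
Hypothesis SN : cubature N.

Definition haar_monomial (i j k l : nat) : C :=
  if (i == l) && (j == k) then beta C i j else 0.

Lemma mean_monomial m : (mdeg m <= N)%N -> mean 'X_[m] =
  haar_monomial (m (vidx 0 0)) (m (vidx 0 1)) (m (vidx 1 0)) (m (vidx 1 1)).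
Proof.
move=> le_mN.
have le i a : (m (vidx i a) <= N)%N.
  by apply: leq_trans le_mN; rewrite mdegE (bigD1 (vidx i a)) //= leq_addr.
rewrite /haar_monomial -SN //; apply: eq_bigr => q _; congr (_ * _); rewrite mevalX.
by rewrite big_vidx !mxvecE.
Qed.

Lemma mdeg4 (m : 'X_{1..2 * 2}) : mdeg m =
  (m (vidx 0%R 0%R) + m (vidx 0%R 1%R) + m (vidx 1%R 0%R) + m (vidx 1%R 1%R))%N.
Proof.
by rewrite mdegE big_vidx.
Qed.

Lemma haar_monomial_sym (i j k l : nat) : haar_monomial i j k l = haar_monomial l k j i.
Proof.
rewrite /haar_monomial [l == i]eq_sym [k == j]eq_sym.
by case: eqP => // ->; case: eqP => // ->.
Qed.

Let half_deg (i j : nat) : ((i + j + j + i.+1).+1./2 = (i + j).+1)%N.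
Proof.
by rewrite addnS -addnA [(j + i)%N]addnC addnn -doubleS doubleK.
Qed.

(** Both sides vanish unless l = i + 1 and j = k; then the denominator is i + j + 2, as in [betaSl].
    The factor [l%:R] neutralizes the default value of [l.-1] at l = 0. *)
Lemma haar_monomialS1 (i j k l : nat) : haar_monomial i.+1 j k l =
  l%:R / (i + j + k + l).+1./2.+1%:R * haar_monomial i j k l.-1.
Proof.
rewrite /haar_monomial; case: l => [|l]; first by rewrite !mul0r.
rewrite eqSS -pred_Sn; case: eqP => [<-|_]; last by rewrite mulr0.
by case: eqP => [<-|_]; rewrite ?mulr0 // half_deg betaSl.
Qed.

Lemma haar_monomialS2 (i j k l : nat) : haar_monomial i j.+1 k l =
  - k%:R / (i + j + k + l).+1./2.+1%:R * haar_monomial i j k.-1 l.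
Proof.
rewrite /haar_monomial; case: k => [|k]; first by rewrite andbF oppr0 !mul0r.
rewrite eqSS -pred_Sn; case: eqP => [<-|_]; last by rewrite mulr0.
case: eqP => [<-|_]; rewrite ?mulr0 // betaSr.
have -> : (i + j + j.+1 + i)%N = (i + j + j + i.+1)%N by rewrite !addnS addSn.
by rewrite half_deg.
Qed.

(** One step of Wick's formula: the propagator pairs a variable only with the one whose two indices
    are both reversed, hence a single derivative. The denominator depends on the degree only; it is
    the radial factor between the uniform measure on the 3-sphere SU(2) and a Gaussian. *)
Lemma mean_coordM_monomial i a m : (mdeg m < N)%N ->
  mean (coord i a * 'X_[m]) =
  (-1) ^+ (i + a) / (mdeg m).+1./2.+1%:R
    * mean (('X_[m])^`M(vidx (rev_ord i) (rev_ord a))).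
Proof.
move=> lt_mN; rewrite -mpolyXD mean_monomial; last by rewrite mdegD mdeg1 add1n.
rewrite mderivX meanZ mean_monomial; last first.
  rewrite (leq_trans _ (ltnW lt_mN)) // !mdegE.
  by apply: leq_sum => k _; rewrite mnmBE leq_subr.
have rev0 : rev_ord 0 = 1 :> 'I_2 by apply: val_inj.
have rev1 : rev_ord 1 = 0 :> 'I_2 by apply: val_inj.
rewrite mdeg4 !mnmDE !mnmBE !mnm1E !vidx_eq.
have rev4 (a00 a01 a10 a11 : nat) : (a11 + a10 + a01 + a00 = a00 + a01 + a10 + a11)%N.
  by rewrite addnC (addnC _ a01) (addnC a11) !addnA.
case: (ord2P i) (ord2P a) => -> [] ->; rewrite ?rev0 ?rev1 /= ?subn0 ?subn1 ?add0n ?add1n;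
  move: (m (vidx 0 0)) (m (vidx 0 1)) (m (vidx 1 0)) (m (vidx 1 1)) => a00 a01 a10 a11.
- by rewrite haar_monomialS1 /= expr0 mul1r mulrA [_^-1 * _]mulrC.
- by rewrite haar_monomialS2 /= expr1 mulN1r mulrA !mulNr [_^-1 * _]mulrC.
- rewrite haar_monomial_sym [in RHS]haar_monomial_sym haar_monomialS2 rev4 /=.
  by rewrite expr1 mulN1r mulrA !mulNr [_^-1 * _]mulrC.
- rewrite haar_monomial_sym [in RHS]haar_monomial_sym haar_monomialS1 rev4 /=.
  by rewrite sqrrN expr1n mul1r mulrA [_^-1 * _]mulrC.
Qed.

Lemma mean_coordM i a d p : p \is d.-homog -> (d < N)%N ->
  mean (coord i a * p) =
  (-1) ^+ (i + a) / d.+1./2.+1%:R * mean (p^`M(vidx (rev_ord i) (rev_ord a))).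
Proof.
move=> /dhomogP hp lt_dN; rewrite {1 2}[p]mpolyE mulr_sumr raddf_sum !mean_sum mulr_sumr.
apply: eq_big_seq => m /hp /= dm; rewrite -scalerAr linearZ !meanZ.
by rewrite mean_coordM_monomial ?dm // mulrCA.
Qed.

Definition form i j (B : 'M[C]_2) : {mpoly C[2 * 2]} :=
  \sum_a \sum_b B a b *: (coord i a * coord j b).

Lemma form_eval i j B (A : 'M[C]_2) :
  (form i j B).@[mxvec A 0] = (A *m B *m A^T) i j.
Proof.
rewrite raddf_sum mxE /=; under eq_bigr do rewrite raddf_sum.
rewrite exchange_big; apply: eq_bigr => b _ /=; rewrite mxE mulr_suml.
apply: eq_bigr => a _.
by rewrite mevalZ mevalM !mevalXU !mxvecE mxE mulrA [_ * B a b]mulrC.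
Qed.

Lemma form_homog i j B : form i j B \is 2.-homog.
Proof.
apply: rpred_sum => a _; apply: rpred_sum => b _; apply: dhomogZ.
by apply: (@dhomogM _ _ _ 1 _ 1); rewrite dhomogX /= mdeg1.
Qed.

(* The derivation that replaces row [k] of the generic matrix [P] by row [j] of
   [P G]. *)
Definition contract j k (G : 'M[C]_2) f : {mpoly C[2 * 2]} :=
  \sum_b \sum_c G b c *: (coord j b * f^`M(vidx k c)).

Lemma contractM j k G p f :
  contract j k G (p * f) = contract j k G p * f + p * contract j k G f.
Proof.
rewrite /contract mulr_suml mulr_sumr -big_split; apply: eq_bigr => b _ /=.
rewrite mulr_suml mulr_sumr -big_split; apply: eq_bigr => c _ /=.
by rewrite mderivM mulrDr scalerDr -scalerAl -scalerAr !mulrA [p * _]mulrC.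
Qed.

Lemma contract1 j k G : contract j k G 1 = 0.
Proof.
rewrite /contract big1 // => b _; rewrite big1 // => c _.
by rewrite -mpolyC1 mderivC mulr0 scaler0.
Qed.

Lemma mderiv_coord k c i a :
  (coord i a)^`M(vidx k c) = ((i == k) && (a == c))%:R%:MP.
Proof.
rewrite mderivX mnm1E vidx_eq; case: andP => [[/eqP-> /eqP->]|_].
  rewrite scale1r mpolyC1 -mpolyX0; congr 'X_[_].
  by apply/mnmP => l; rewrite mnmBE mnm0E subnn.
by rewrite scale0r mpolyC0.
Qed.

(** Leibniz rule on P B P^T. Replacing the second row gives the entry (i', j) of P B G^T P^T, which
    is transposed so that [j] comes first. *)
Lemma contract_form j k G i' j' B : contract j k G (form i' j' B) =
  (i' == k)%:R *: form j j' (G *m B) + (j' == k)%:R *: form j i' (G *m B^T).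
Proof.
have dE c : (form i' j' B)^`M(vidx k c) =
    (i' == k)%:R *: \sum_b B c b *: coord j' b
  + (j' == k)%:R *: \sum_b B b c *: coord i' b.
  have sum_delta (F : 'I_2 -> {mpoly C[2 * 2]}) : \sum_a (a == c)%:R *: F a = F c.
    rewrite (bigD1 c) //= eqxx scale1r big1 ?addr0 // => a /negbTE->.
    by rewrite scale0r.
  transitivity (\sum_a ((a == c)%:R *: ((i' == k)%:R *: \sum_b B a b *: coord j' b)
                       + (j' == k)%:R *: (B a c *: coord i' a))); last first.
    by rewrite big_split sum_delta /= -scaler_sumr.
  rewrite raddf_sum; apply: eq_bigr => a _ /=; rewrite raddf_sum /=.
  rewrite -(sum_delta (fun b => B a b *: coord i' a)) !scaler_sumr -big_split.
  apply: eq_bigr => b _ /=; rewrite mderivZ mderivM !mderiv_coord mul_mpolyC [_ * _%:MP]mulrC mul_mpolyC.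
  rewrite -!mulnb !natrM !scalerDr !scalerA.
  by congr (_ *: _ + _ *: _); ring.
rewrite /contract /form !scaler_sumr -big_split; apply: eq_bigr => b _ /=.
under eq_bigr do rewrite dE mulrDr scalerDr -!scalerAr ![G _ _ *: (_ *: _)]scalerA
   ![G _ _ * _]mulrC -!scalerA.
rewrite big_split -!scaler_sumr /=; congr (_ *: _ + _ *: _).
  under eq_bigr do rewrite mulr_sumr scaler_sumr.
  rewrite exchange_big; apply: eq_bigr => b' _ /=.
  rewrite mxE scaler_suml; apply: eq_bigr => c _.
  by rewrite -scalerAr scalerA.
under eq_bigr do rewrite mulr_sumr scaler_sumr.
rewrite exchange_big; apply: eq_bigr => b' _ /=.
rewrite mxE scaler_suml; apply: eq_bigr => c _.
by rewrite mxE -scalerAr scalerA.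
Qed.

Definition skew2 : 'M[C]_2 := \matrix_(i, j) ((i < j)%:R - (j < i)%:R).

(** From A E A^T = E and E^T = - E, where E = [skew2]. *)
Lemma sl2_skew_tr (A : SL2 C) : ((A : 'M_2) *m skew2)^T = - ((A^-1)%g *m skew2).
Proof.
rewrite sl2_valV; have [a00 a01 a10 a11] := adj2E (A : 'M_2).
apply: matrix2P; rewrite [LHS]mxE [RHS]mxE !mulmx2E ?(a00, a01, a10, a11) !mxE /=;
  entries (A : 'M_2); ring.
Qed.

(** The first variable of the form is contracted either with the second one, where A E paired with E
    gives tr A, or with a variable of [f], where the form acts through E^T A^T E = A^-1. *)
Lemma mean_formM i j (A : SL2 C) d f : f \is d.-homog -> (d.+1 < N)%N ->
  mean (form i j ((A : 'M_2) *m skew2) * f) = (-1) ^+ i / d.+2./2.+1%:R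
    * ((j == rev_ord i)%:R * \tr A * mean f + mean (contract j (rev_ord i) (A^-1)%g f)).
Proof.
move=> hf lt_dN.
have rev0 : rev_ord 0 = 1 :> 'I_2 by apply: val_inj.
have rev1 : rev_ord 1 = 0 :> 'I_2 by apply: val_inj.
pose M b c := mean (coord j b * f^`M(vidx (rev_ord i) c)).
have E a b : mean (coord i a * (coord j b * f)) = (-1) ^+ i / d.+2./2.+1%:R * ((-1) ^+ a
    * ((j == rev_ord i)%:R * (b == rev_ord a)%:R * mean f + M b (rev_ord a))).
  rewrite (@mean_coordM _ _ d.+1) //; last first.
    by apply: (@dhomogM _ _ _ 1) => //; rewrite dhomogX /= mdeg1.
  rewrite mderivM mderiv_coord mul_mpolyC meanD meanZ -mulnb natrM exprD.
  by rewrite -!mulrA; congr (_ * _); rewrite mulrCA.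
have -> : mean (form i j (A *m skew2) * f) = \sum_a \sum_b (A *m skew2) a b
    * mean (coord i a * (coord j b * f)).
  rewrite /form mulr_suml mean_sum; apply: eq_bigr => a _.
  rewrite mulr_suml mean_sum; apply: eq_bigr => b _.
  by rewrite -scalerAl meanZ mulrA.
under eq_bigr do under eq_bigr do rewrite E mulrCA.
have -> : mean (contract j (rev_ord i) (A^-1)%g f) = \sum_b \sum_c \adj (A : 'M_2) b c
    * M b c.
  rewrite mean_sum; apply: eq_bigr => b _; rewrite mean_sum; apply: eq_bigr => c _.
  by rewrite meanZ sl2_valV.
move: M (mean f) {E} => M x; move: (_ / _) (j == _)%:R => h e.
rewrite !sum_ord2; have [-> -> -> ->] := adj2E (A : 'M_2).
rewrite !mulmx2E mxtrace2E rev0 rev1 !mxE /= -[(1 %% 2)%N]/1%N expr0 expr1.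
entries (A : 'M_2); entries M; ring.
Qed.

End Wick.

(** * Invariants of tuples in SL_2 *)

Section FirstFundamentalTheorem.
Local Open Scope ring_scope.
Variables (C : numFieldType) (s : nat).
Implicit Types (w : word s) (vs : seq (word s)).

(* [(i, j, w)] stands for the entry [(i, j)] of [P w(z) E P^T], [E = skew2]. *)
Definition item := ('I_2 * 'I_2 * word s)%type.
Implicit Types (it : item) (its pre suf : seq item).

Definition item_form (z : 'I_s -> SL2 C) it : {mpoly C[2 * 2]} :=
  form it.1.1 it.1.2 ((wval z it.2 : 'M_2) *m skew2 C).

Definition items_form z its : {mpoly C[2 * 2]} := \prod_(it <- its) item_form z it.

Lemma items_form_homog z its : items_form z its \is (size its).*2.-homog.
Proof.
elim: its => [|it its IH]; rewrite /items_form ?big_nil ?dhomog1 // big_cons.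
by apply: (@dhomogM _ _ _ 2 _ (size its).*2) => //; apply: form_homog.
Qed.

(** Contraction joins two words. Through the second index the form is transposed, which by
    [sl2_skew_tr] inverts its word and changes the sign. *)
Lemma contract_item z j k w it :
  contract j k ((wval z w)^-1%g : SL2 C) (item_form z it) =
  (it.1.1 == k)%:R *: item_form z (j, it.1.2, winv w ++ it.2)
  - (it.1.2 == k)%:R *: item_form z (j, it.1.1, winv w ++ winv it.2).
Proof.
rewrite /item_form contract_form sl2_skew_tr -scalerN; congr (_ *: _ + _ *: _) => /=.
  by rewrite wval_cat wval_inv mulmxA.
rewrite !wval_cat !wval_inv sl2_valM mulmxN mulmxA /form.
by rewrite -sumrN; apply: eq_bigr => a _; rewrite -sumrN; apply: eq_bigr => b _;
  rewrite mxE scaleNr.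
Qed.

Variables (S : seq (C * SL2 C)) (N : nat).
Hypothesis SN : cubature S N.

Definition letters vs its := flatten vs ++ flatten [seq it.2 | it <- its].

Lemma item_trace_step (z : 'I_s -> SL2 C) i j w its :
  ((size its).*2.+1 < N)%N ->
  mean S (items_form z ((i, j, w) :: its)) =
    (-1) ^+ i / (size its).*2.+2./2.+1%:R *
    ((j == rev_ord i)%:R * \tr (wval z w : 'M_2) * mean S (items_form z its)
     + mean S (contract j (rev_ord i) ((wval z w)^-1%g : SL2 C) (items_form z its))).
Proof.
move=> lt_N; rewrite /items_form big_cons.
exact: (mean_formM SN _ _ _ (items_form_homog z its)).
Qed.

Variables (x y : 'I_s -> SL2 C).
Hypothesis sqr_agree : forall w,
  \tr (wval x w : 'M_2) ^+ 2 = \tr (wval y w : 'M_2) ^+ 2.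

(* Contracting the first form against itself yields a trace, against another
   form it merges the two words: what remains in the end are traces of words. *)
Lemma mean_items_agree vs its : ((size its).*2 <= N)%N ->
    (forall k, ~~ odd (wletter k (letters vs its))) ->
  \prod_(v <- vs) \tr (wval x v : 'M_2) * mean S (items_form x its) =
  \prod_(v <- vs) \tr (wval y v : 'M_2) * mean S (items_form y its).
Proof.
have [n] := ubnP (size its).
elim: n vs its => // n IH vs [|[[i j] w] its] /ltnSE le_n le_N ev.
  rewrite /letters cats0 in ev.
  by rewrite (even_trace_agree sqr_agree ev) /items_form !big_nil.
have lt_N : ((size its).*2.+1 < N)%N by rewrite -doubleS.
(* Leibniz rule along the list: the derivation has passed [pre] and still has to act on [suf]. The
   letters of [w] are counted in the parity condition because they move into the form that is
   hit. *)
have contracted pre suf : (size pre + size suf < n)%N ->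
    ((size pre + size suf).*2 <= N)%N ->
    (forall k, ~~ odd (wletter k (w ++ letters vs (pre ++ suf)))) ->
    \prod_(v <- vs) \tr (wval x v : 'M_2) * mean S (items_form x pre *
      contract j (rev_ord i) ((wval x w)^-1%g : SL2 C) (items_form x suf)) =
    \prod_(v <- vs) \tr (wval y v : 'M_2) * mean S (items_form y pre *
      contract j (rev_ord i) ((wval y w)^-1%g : SL2 C) (items_form y suf)).
  elim: suf pre => [|it suf IHs] pre le_sn le_sN evs.
    by rewrite /items_form !big_nil !contract1 !mulr0 !mean0 !mulr0.
  pose e1 : C := (it.1.1 == rev_ord i)%:R; pose e2 : C := (it.1.2 == rev_ord i)%:R.
  have E z : mean S (items_form z pre * contract j (rev_ord i) ((wval z w)^-1%g : SL2 C)
      (items_form z (it :: suf))) =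
    e1 * mean S (items_form z (pre ++ (j, it.1.2, winv w ++ it.2) :: suf))
    - e2 * mean S (items_form z (pre ++ (j, it.1.1, winv w ++ winv it.2) :: suf))
    + mean S (items_form z (rcons pre it) *
        contract j (rev_ord i) ((wval z w)^-1%g : SL2 C) (items_form z suf)).
    rewrite [items_form z (it :: suf)]big_cons contractM contract_item.
    rewrite mulrDr meanD; congr (_ + _); last first.
      by rewrite /items_form -cats1 big_cat big_seq1 /= mulrA.
    rewrite /items_form !big_cat !big_cons /= -!meanZ -meanB; congr (mean _ _).
    by rewrite mulrBl mulrBr -!scalerAl -!scalerAr.
  have size_mid it' : size (pre ++ it' :: suf) = (size pre + (size suf).+1)%N.
    by rewrite size_cat.
  have lin3 (p p' a b c a' b' c' m m' : C) : m = e1 * a - e2 * b + c ->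
      m' = e1 * a' - e2 * b' + c' -> p * a = p' * a' -> p * b = p' * b' ->
      p * c = p' * c' -> p * m = p' * m'.
    move=> -> -> Ea Eb Ec; transitivity (e1 * (p * a) - e2 * (p * b) + p * c); first by ring.
    by rewrite Ea Eb Ec; ring.
  apply: lin3 (E x) (E y) _ _ _.
  - apply: IH; rewrite ?size_mid // => k; have := evs k.
    by rewrite /letters !map_cat !flatten_cat /= !wletterE !oddD; do 5?case: (odd (wletter k _)).
  - apply: IH; rewrite ?size_mid // => k; have := evs k.
    by rewrite /letters !map_cat !flatten_cat /= !wletterE !oddD; do 5?case: (odd (wletter k _)).
  - by apply: IHs; rewrite ?size_rcons ?addSnnS // => k; rewrite cat_rcons.
have lin2 (p p' t t' m m' c c' h e n1 n1' : C) : n1 = h * (e * t * m + c) ->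
    n1' = h * (e * t' * m' + c') -> t * p * m = t' * p' * m' -> p * c = p' * c' ->
    p * n1 = p' * n1'.
  move=> -> -> Em Ec; transitivity (h * (e * (t * p * m) + p * c)); first by ring.
  by rewrite Em Ec; ring.
apply: lin2 (item_trace_step x i j w lt_N) (item_trace_step y i j w lt_N) _ _.
  have := IH (w :: vs) its le_n; rewrite !big_cons; apply.
    by rewrite (leq_trans _ le_N) // leq_double.
  by move=> k; have := ev k; rewrite /letters /= !wletterE !oddD; do 5?case: (odd (wletter k _)).
have := contracted [::] its; rewrite /items_form !big_nil !mul1r; apply=> //.
  by rewrite (leq_trans _ le_N) // leq_double.
by move=> k; have := ev k; rewrite /letters /= !wletterE !oddD; do 5?case: (odd (wletter k _)).
Qed.

End FirstFundamentalTheorem.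

(** * The adjoint representation *)

Section AdjointRepresentation.
Local Open Scope ring_scope.
Local Open Scope quotient_scope.
Variable C : numClosedFieldType.
Implicit Types (A B : SL2 C) (P Q : PSL2 C) (M : 'M[C]_3) (X Y : 'M[C]_2).

Let nz2 : 2 != 0 :> C. Proof. by rewrite pnatr_eq0. Qed.
Let i2 : 'i * 'i = -1 :> C. Proof. by rewrite -expr2 sqrCi. Qed.

Lemma pi_mulg A B : \pi_(PSL2 C) (A * B)%g = (\pi_(PSL2 C) A * \pi_(PSL2 C) B)%g.
Proof. exact: pi_psl2_mul. Qed.

Lemma pi_invg A : \pi_(PSL2 C) (A^-1)%g = (\pi_(PSL2 C) A)^-1%g.
Proof. exact: pi_psl2_inv. Qed.

Lemma adjoint_pi A : adjoint (\pi_(PSL2 C) A) = sl2_adjoint A.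
Proof. by rewrite piE. Qed.

Lemma tr2_pi A : tr2 (\pi_(PSL2 C) A) = \tr (A : 'M_2) ^+ 2.
Proof. by rewrite piE. Qed.

Lemma adjointM P Q : adjoint (P * Q)%g = adjoint P *m adjoint Q.
Proof.
elim/quotW: P => A; elim/quotW: Q => B.
by rewrite -pi_mulg !adjoint_pi; apply: sl2_adjointM.
Qed.

Lemma adjointV P : adjoint P^-1%g = (adjoint P)^T.
Proof. by elim/quotW: P => A; rewrite -pi_invg !adjoint_pi; apply: sl2_adjointV. Qed.

Lemma adjoint1 : adjoint (1%g : PSL2 C) = 1%:M.
Proof.
rewrite -[1%g]/(psl2_one C) /psl2_one; unlock; rewrite adjoint_pi; exact: sl2_adjoint1.
Qed.

Lemma pauliM_tr k l : \tr (pauli C k *m pauli C l) = (k == l)%:R * 2.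
Proof.
rewrite mxtrace2E !mulmx2E /pauli !(tnth_nth 0).
by case: k => -[|[|[|//]]] ?; case: l => -[|[|[|//]]] ?;
  rewrite /= !mxE /= /eq_op /=; field: i2.
Qed.

(** Conjugation on M_2 is the sum of the adjoint and the trivial representation, and its trace is tr
    A tr A^-1. *)
Lemma tr2_adjoint P : tr2 P = \tr (adjoint P) + 1.
Proof.
elim/quotW: P => A; rewrite tr2_pi adjoint_pi.
have dA := sl2_det_entries A.
rewrite /mxtrace !big_ord_recl !big_ord0 !mxE !mxtrace2E !mulmx2E.
rewrite -[invmx A]/((A^-1)%g : 'M_2) sl2_valV /pauli !(tnth_nth 0) /=.
have [-> -> -> ->] := adj2E (A : 'M_2); rewrite !mxE /= ?lift_ord2.
move: dA => /eqP; rewrite subr_eq => /eqP.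
entries (A : 'M_2) => dA; by field: i2 dA.
Qed.

Definition conj_pauli M k : 'M[C]_2 := \sum_i M i k *: pauli C i.

(* The linear map fixing 1 and acting on the Pauli matrices through [M]; it is
   conjugation by [A] when [M] is the adjoint matrix of [A]. *)
Definition conj_map M X : 'M[C]_2 :=
  (\tr X / 2)%:M + \sum_k (\tr (pauli C k *m X) / 2) *: conj_pauli M k.

Lemma conj_mapD M X Y : conj_map M (X + Y) = conj_map M X + conj_map M Y.
Proof.
rewrite /conj_map addrACA -big_split -raddfD -mulrDl -mxtraceD /=; congr (_ + _).
by apply: eq_bigr => k _ /=; rewrite -scalerDl -mulrDl -mxtraceD mulmxDr.
Qed.

Lemma conj_mapZ M a X : conj_map M (a *: X) = a *: conj_map M X.
Proof.
rewrite /conj_map scalerDr scale_scalar_mx mxtraceZ mulrA scaler_sumr; congr (_ + _).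
by apply: eq_bigr => k _ /=; rewrite -scalemxAr mxtraceZ scalerA mulrA.
Qed.

Lemma conj_map1 M : conj_map M 1%:M = 1%:M.
Proof.
rewrite /conj_map mxtrace1 divff // big1 ?addr0 // => k _.
by rewrite mulmx1 pauli_tr0 mul0r scale0r.
Qed.

Lemma conj_map_pauli M k : conj_map M (pauli C k) = conj_pauli M k.
Proof.
rewrite /conj_map pauli_tr0 mul0r raddf0 add0r (bigD1 k) //= pauliM_tr eqxx mul1r.
rewrite divff // scale1r big1 ?addr0 // => l /negbTE neq.
by rewrite pauliM_tr neq !mul0r scale0r.
Qed.

Lemma pauli_decomp X :
  X = (\tr X / 2)%:M + \sum_k (\tr (pauli C k *m X) / 2) *: pauli C k.
Proof.
rewrite -[LHS](subrKC (\tr X / 2)%:M); congr (_ + _).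
rewrite {1}[X - _]pauli_coord; last first.
  by rewrite raddfB /= mxtrace_scalar -[_ *+ 2]mulr_natr divfK // subrr.
apply: eq_bigr => k _; congr (_ / _ *: _).
by rewrite mulmxBr raddfB /= mul_mx_scalar mxtraceZ pauli_tr0 mulr0 subr0.
Qed.

Lemma conj_map_adjoint A X :
  conj_map (sl2_adjoint A) X = (A : 'M_2) *m X *m (A^-1)%g.
Proof.
rewrite {2}[X]pauli_decomp mulmxDr mulmxDl mul_mx_scalar -scalemxAl.
rewrite mulmxV ?sl2_unit // scalemx1; congr (_ + _).
rewrite mulmx_sumr mulmx_suml; apply: eq_bigr => k _.
by rewrite -scalemxAr -scalemxAl sl2_adjointE.
Qed.

(** Polynomial equations in the entries of [M], making [conj_map M] an algebra endomorphism of M_2.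
    They take the place of the equations of SO_3. *)
Definition conj_multiplicative M := forall k l,
  conj_pauli M k *m conj_pauli M l = conj_map M (pauli C k *m pauli C l).

Lemma adjoint_conj_multiplicative A : conj_multiplicative (sl2_adjoint A).
Proof.
move=> k l; rewrite -!conj_map_pauli !conj_map_adjoint !mulmxA.
by rewrite mulmxKV ?sl2_unit.
Qed.

Lemma conj_map_sum M (I : finType) (F : I -> 'M[C]_2) :
  conj_map M (\sum_i F i) = \sum_i conj_map M (F i).
Proof.
apply: (big_morph _ (conj_mapD M)); rewrite -(scale0r 0) conj_mapZ !scale0r //.
Qed.

Lemma conj_mapM M X Y : conj_multiplicative M ->
  conj_map M (X *m Y) = conj_map M X *m conj_map M Y.
Proof.
move=> mulM.
have mulP k : conj_map M (pauli C k *m Y) = conj_pauli M k *m conj_map M Y.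
  rewrite {1}[Y]pauli_decomp mulmxDr mul_mx_scalar mulmx_sumr conj_mapD conj_map_sum.
  rewrite conj_mapZ conj_map_pauli mulmxDr mul_mx_scalar mulmx_sumr.
  congr (_ + _); apply: eq_bigr => l _.
  by rewrite -!scalemxAr conj_mapZ -mulM.
rewrite {1}[X]pauli_decomp mulmxDl mul_scalar_mx mulmx_suml conj_mapD conj_map_sum.
rewrite conj_mapZ [conj_map M X]/conj_map mulmxDl mul_scalar_mx mulmx_suml.
congr (_ + _); apply: eq_bigr => l _.
by rewrite -!scalemxAl conj_mapZ mulP.
Qed.

(* Skolem-Noether for M_2: column [k] of [A] is the image of a vector in the
   range of [Phi e_00] under [Phi e_k0], where [Phi = conj_map M]. *)
Lemma sl2_adjoint_surj M : conj_multiplicative M -> exists A, sl2_adjoint A = M.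
Proof.
move=> mulM; pose e k l : 'M[C]_2 := delta_mx k l.
pose phi := conj_map M.
have phiM X Y : phi (X *m Y) = phi X *m phi Y by apply: conj_mapM.
have [v vP] : exists v : 'cV[C]_2, phi (e 0 0) *m v != 0.
  have phi00 : phi (e 0 0) != 0.
    apply/eqP => phi0; have : phi 1%:M = 0.
      have -> : 1%:M = \sum_i e i 0 *m e 0 0 *m e 0 i.
        by rewrite mx1_sum_delta; apply: eq_bigr => i _; rewrite !mul_delta_mx.
      rewrite /phi conj_map_sum big1 // => i _.
      by rewrite -/phi !phiM phi0 mulmx0 mul0mx.
    by rewrite /phi conj_map1 => /matrixP/(_ 0 0) /eqP; rewrite !mxE oner_eq0.
  apply/not_existsP => phi_v; case/eqP: phi00; apply/matrixP => i j.
  have /negP := phi_v (delta_mx j 0); rewrite negbK => /eqP /matrixP/(_ i 0).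
  by rewrite -colE !mxE.
pose B : 'M[C]_2 := \sum_k phi (e k 0) *m v *m delta_mx 0 k.
have BE Y : phi Y *m B = B *m Y.
  rewrite /B mulmx_sumr mulmx_suml.
  transitivity (\sum_k \sum_j Y j k *: (phi (e j 0) *m v *m delta_mx 0 k)).
    apply: eq_bigr => k _; rewrite !mulmxA -phiM.
    have -> : Y *m e k 0 = \sum_j Y j k *: e j 0.
      apply: matrix2P; rewrite sum_ord2 !(mulmx2E, mxE);
      by case: (ord2P k) => -> /=; rewrite ?(mulr1, mulr0, addr0, add0r).
    rewrite /phi conj_map_sum -mulmxA mulmx_suml; apply: eq_bigr => j _.
    by rewrite conj_mapZ -scalemxAl mulmxA.
  rewrite exchange_big; apply: eq_bigr => j _ /=.
  rewrite -[RHS]mulmxA -rowE [row j Y]row_sum_delta mulmx_sumr.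
  by apply: eq_bigr => k _; rewrite mxE -scalemxAr.
have B0 i : B i 0 = (phi (e 0 0) *m v) i 0.
  rewrite /B summxE sum_ord2 !mxE !big_ord1 !mxE /=.
  by rewrite !(mulr1, mulr0, addr0).
(* If det B = 0, then B Y adj B = phi(Y) B adj B = 0 for every Y, so all products of an entry of B
   and one of adj B vanish. These include, up to sign, the squares of the entries of column 0, which
   is nonzero. *)
have detB : \det B != 0.
  apply/eqP => detB.
  have adj0 a b i j : B i a * (\adj B) b j = 0.
    have /matrixP/(_ i j) : B *m e a b *m \adj B = 0.
      by rewrite -BE -mulmxA mul_mx_adj detB raddf0 mulmx0.
    rewrite /e -(mul_delta_mx (0 : 'I_1)) mulmxA -colE -mulmxA -rowE.
    by rewrite mxE big_ord1 !mxE.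
  case/eqP: vP; apply/matrixP => i j; rewrite ord1 -B0 mxE.
  have [a00 a01 a10 a11] := adj2E B.
  have := adj0 0 1 i (rev_ord i).
  case: (ord2P i) => ->.
    rewrite (_ : rev_ord 0 = 1) ?a11; last exact: val_inj.
    by move/eqP; rewrite mulf_eq0 orbb => /eqP.
  rewrite (_ : rev_ord 1 = 0) ?a10; last exact: val_inj.
  by move/eqP; rewrite mulrN oppr_eq0 mulf_eq0 orbb => /eqP.
pose r := sqrtC (\det B).
have r0 : r != 0 by rewrite sqrtC_eq0.
have detA : \det (r^-1 *: B) == 1.
  by rewrite detZ exprVn sqrtCK mulVf.
exists (MkSL2 detA); apply/matrixP => i k; rewrite mxE /=.
have uA := sl2_unit (MkSL2 detA); rewrite /= in uA.
have -> : r^-1 *: B *m pauli C k *m invmx (r^-1 *: B) = conj_pauli M k.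
  apply: (can_inj (mulmxK uA)); rewrite mulmxKV // -scalemxAl -BE.
  by rewrite -scalemxAr /phi conj_map_pauli.
rewrite mulmx_sumr raddf_sum mulr_suml (bigD1 i) //= -scalemxAr mxtraceZ pauliM_tr.
rewrite eqxx mul1r mulfK // big1 ?addr0 // => l; rewrite eq_sym => /negbTE neq.
by rewrite -scalemxAr mxtraceZ pauliM_tr neq !(mul0r, mulr0).
Qed.

(** B^-1 A commutes with every matrix, so it is a scalar, and determinant 1 leaves only the
    signs. *)
Lemma sl2_adjoint_inj A B : sl2_adjoint A = sl2_adjoint B ->
  \pi_(PSL2 C) A = \pi_(PSL2 C) B.
Proof.
move=> eqAB; have uA := sl2_unit A; have uB := sl2_unit B.
pose D : 'M[C]_2 := invmx B *m A.
have com X : D *m X = X *m D.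
  have := conj_map_adjoint A X; rewrite eqAB conj_map_adjoint.
  rewrite -[(A^-1)%g : 'M_2]/(invmx A) -[(B^-1)%g : 'M_2]/(invmx B) => E.
  have := congr1 (fun Y => invmx B *m Y *m A) E.
  by rewrite /= !mulmxA mulVmx // mul1mx mulmxKV // -!mulmxA => ->.
have AD : A = B *m D :> 'M_2 by rewrite mulKVmx.
move: D com AD => D com AD.
have DE : D = (D 0 0)%:M.
  have /matrixP E01 := com (delta_mx 0 1); have /matrixP E10 := com (delta_mx 1 0).
  have := E01 0 1; have := E01 0 0; have := E10 0 0.
  rewrite !mulmx2E !mxE /= !(mulr1, mulr0, mul0r, mul1r, addr0, add0r) => d01 d10 d11.
  by apply: matrix2P; rewrite [RHS]mxE /= ?mulr1n ?mulr0n ?d01 -?d10 -?d11.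
have AE : A = D 0 0 *: (B : 'M_2) :> 'M_2.
  by rewrite -mul_mx_scalar -DE.
have : D 0 0 ^+ 2 == 1.
  by have := sl2_det A; rewrite AE detZ (eqP (sl2_det B)) mulr1.
rewrite sqrf_eq1 => d1; apply/eqP/eqpmP.
case/orP: d1 => /eqP d1; [left|right]; rewrite AE d1 ?scale1r ?scaleN1r //.
Qed.

Lemma adjoint_inj : injective (@adjoint C).
Proof.
elim/quotW=> A; elim/quotW=> B; rewrite !adjoint_pi; exact: sl2_adjoint_inj.
Qed.

End AdjointRepresentation.

(** * The Nullstellensatz *)

Section Nullstellensatz.
Local Open Scope ring_scope.
Variable C : closedFieldType.

Lemma monomial_list n (m : 'X_{1..n}) : exists2 ks : seq 'I_n, size ks = mdeg m &
  forall (R : comNzRingType) (v : 'I_n -> R), \prod_i v i ^+ m i = \prod_(k <- ks) v k.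
Proof.
exists (flatten [seq nseq (m i) i | i <- enum 'I_n]) => [|R v].
  rewrite size_flatten /shape -map_comp mdegE sumnE big_map big_enum.
  by apply: eq_bigr => i _; rewrite /= size_nseq.
rewrite big_flatten big_map big_enum; apply: eq_bigr => i _.
by rewrite big_nseq iter_mulr_1.
Qed.

Lemma mmap_comp (A B : comNzRingType) (phi : {rmorphism A -> B}) n (iota : C -> A)
    (x : 'I_n -> A) p : phi (mmap iota x p) = mmap (phi \o iota) (phi \o x) p.
Proof.
rewrite rmorph_sum; apply: eq_bigr => m _; rewrite rmorphM rmorph_prod.
by congr (_ * _); apply: eq_bigr => i _; rewrite rmorphXn.
Qed.

Lemma mmap_ext (A : comNzRingType) n (iota iota' : C -> A) (x x' : 'I_n -> A) p :
  iota =1 iota' -> x =1 x' -> mmap iota x p = mmap iota' x' p.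
Proof.
by move=> eq_i eq_x; apply: eq_bigr => m _; rewrite eq_i (mmap1_eq _ eq_x).
Qed.

Definition ord_rcons (T : Type) n (a : 'I_n -> T) (b : T) (i : 'I_n.+1) : T :=
  oapp a b (unlift ord_max i).

Lemma ord_rcons_lift T n (a : 'I_n -> T) b i : ord_rcons a b (lift ord_max i) = a i.
Proof. by rewrite /ord_rcons liftK. Qed.

Lemma ord_rcons_max T n (a : 'I_n -> T) b : ord_rcons a b ord_max = b.
Proof. by rewrite /ord_rcons unlift_none. Qed.

Lemma ord_rcons_widen T n (a : 'I_n -> T) b (i : 'I_n) :
  ord_rcons a b (widen_ord (leqnSn n) i) = a i.
Proof.
rewrite (_ : widen_ord _ i = lift ord_max i) ?ord_rcons_lift //.
by apply: val_inj; rewrite /= /bump leqNgt ltn_ord.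
Qed.

Lemma mpoly0_const (p : {mpoly C[0]}) a : p = (p.@[a])%:MP.
Proof.
suff pE : p = (p@_0)%:MP by rewrite {2}pE mevalC.
apply/mpolyP => m; rewrite mcoeffC (_ : m = 0%MM) ?eqxx ?mulr1 //.
by apply/mnmP => -[].
Qed.

Lemma muni_eval n (p : {mpoly C[n.+1]}) a b :
  (map_poly (meval a) (muni p)).[b] = p.@[ord_rcons a b].
Proof.
rewrite muniE rmorph_sum horner_sum mevalE; apply: eq_bigr => m _.
rewrite /= map_polyZ map_polyXn hornerZ hornerXn [X in X * _ = _](mevalZ a) mevalX.
rewrite big_ord_recr /=.
rewrite ord_rcons_max mulrA; congr (_ * _ * _); apply: eq_bigr => i _.
by rewrite ord_rcons_widen mnmE.
Qed.

Lemma muni_eq0 n (p : {mpoly C[n.+1]}) : (muni p == 0) = (p == 0).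
Proof.
have [->|p0] := eqVneq p 0; first by rewrite muni0 eqxx.
have mp := mlead_supp p0; set m := mlead p in mp.
pose w (m : 'X_{1..n.+1}) := [multinom m (widen_ord (leqnSn n) i) | i < n].
have mE m1 : (m1 == m) = (m1 ord_max == m ord_max) && (w m1 == w m).
  apply/eqP/andP => [->|[/eqP eq_max /eqP/mnmP eq_w]]; first by rewrite !eqxx.
  apply/mnmP => i; case: (unliftP ord_max i) => [j|] -> //.
  have := eq_w j; rewrite !mnmE (_ : widen_ord _ j = lift ord_max j) //.
  by apply: val_inj; rewrite /= /bump leqNgt ltn_ord.
apply/negbTE; apply: contraTneq mp => muni0.
rewrite -mcoeff_eq0; apply/eqP.
have : (muni p)`_(m ord_max)@_(w m) = 0 by rewrite muni0 coef0 mcoeff0.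
rewrite muniE coef_sum raddf_sum /= => <-.
transitivity (\sum_(m1 <- msupp p) (m1 == m)%:R * p@_m1).
  have [mp|mp] := boolP (m \in msupp p).
    rewrite (bigD1_seq m) //= eqxx mul1r big1 ?addr0 // => m1 /negbTE->.
    by rewrite mul0r.
  rewrite memN_msupp_eq0 // big_seq big1 // => m1 m1p.
  by rewrite (negbTE (memPn mp _ m1p)) mul0r.
apply: eq_bigr => m1 _; rewrite coefZ coefXn mulr_natr mcoeffMn mcoeffZ mcoeffX mE.
rewrite [m ord_max == _]eq_sym.
by case: (_ == _); case: (_ == _); rewrite ?(mul1r, mul0r, mulr1, mulr0, mulr1n, mulr0n).
Qed.

Lemma mpoly_neq0_meval n (p : {mpoly C[n]}) : p != 0 -> exists a, p.@[a] != 0.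
Proof.
elim: n p => [|n IH] p p0.
  by exists (fun=> 0); apply: contra_neq p0 => pa; rewrite (mpoly0_const p (fun=> 0)) pa.
have [a lead_a] : exists a, (lead_coef (muni p)).@[a] != 0.
  by apply: IH; rewrite lead_coef_eq0 muni_eq0.
have /closed_nonrootP[b] : map_poly (meval a) (muni p) != 0.
  apply: contra_neq lead_a => /polyP/(_ (size (muni p)).-1).
  by rewrite coef_map coef0.
by rewrite /root muni_eval => pab; exists (ord_rcons a b).
Qed.

(** A monomial restricted to the line c + l X has as top coefficient its value at the direction [l];
    this is what makes a relation monic after a linear change of variables. *)
Lemma prod_linear_top (B : comNzRingType) n (c l : 'I_n -> B) (ks : seq 'I_n) :
  let q := \prod_(k <- ks) ((c k)%:P + (l k)%:P * 'X) in
  (size q <= (size ks).+1)%N /\ q`_(size ks) = \prod_(k <- ks) l k.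
Proof.
elim: ks => [|k ks [IHs IHc]] /=; first by rewrite !big_nil size_poly1 coef1.
rewrite !big_cons; set q := \prod_(j <- ks) _ in IHs IHc *; split.
  apply: leq_trans (size_polyMleq _ _) _.
  have le2 : (size ((c k)%:P + (l k)%:P * 'X)%R <= 2)%N.
    apply: leq_trans (size_polyD _ _) _; rewrite geq_max.
    rewrite (leq_trans (size_polyC_leq1 _)) //= mul_polyC.
    by rewrite (leq_trans (size_scale_leq _ _)) ?size_polyX.
  by rewrite -subn1 leq_subLR; apply: leq_add le2 IHs.
rewrite mulrDl coefD coefCM -mulrA coefCM coefXM /= IHc nth_default // mulr0 add0r //.
Qed.

Variable A : comNzRingType.
Variable iota : {rmorphism C -> A}.
Variable S : A -> Prop.
Hypotheses (S0 : S 0) (SD : forall u v, S u -> S v -> S (u + v))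
  (SM : forall u v, S v -> S (u * v)) (S1 : ~ S 1).

Let S_sum (I : Type) (r : seq I) (F : I -> A) :
  (forall i, S (F i)) -> S (\sum_(i <- r) F i).
Proof. by move=> SF; elim/big_ind: _. Qed.

Let S_ring (a : C) : S (iota a) -> a = 0.
Proof.
have [->//|a0] := eqVneq a 0 => Sa; case: S1.
by have := SM (iota a^-1) Sa; rewrite -rmorphM mulVf ?rmorph1.
Qed.

Section Specialization.
Import Pdiv.CommonRing.
Variables (n : nat) (y : 'I_n -> A) (t : A) (a : 'I_n -> C).
Hypothesis aP : forall p, S (mmap iota y p) -> p.@[a] = 0.

Let E : {poly {mpoly C[n]}} -> A := horner_eval t \o map_poly (mmap iota y).
Let nu : {poly {mpoly C[n]}} -> {poly C} := map_poly (meval a).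

Variable F : {poly {mpoly C[n]}}.
Hypotheses (F_monic : F \is monic) (SF : S (E F)).

(* Nakayama: were [nu q = 1], then [X^j q mod F] would have the coefficients of
   a matrix over [C[y]] that specializes to the identity, and whose determinant
   lies in [S]. *)
Lemma specialization_proper q : S (E q) -> nu q != 1.
Proof.
move=> Sq; apply/eqP => nuq1.
have [d sF] : exists d, size F = d.+1.
  by exists (size F).-1; rewrite prednK // lt0n size_poly_eq0 monic_neq0.
pose r j := rmodp ('X^j * q) F.
have r_size j : (size (r j) <= d)%N by rewrite -ltnS -sF ltn_rmodp monic_neq0.
have ED u v : E (u + v) = E u + E v by rewrite /E /= !rmorphD.
have EM u v : E (u * v) = E u * E v by rewrite /E /= !rmorphM.
have Sr j : S (E (r j)).
  have /esym/(canRL (addKr _)) := Pdiv.RingMonic.rdivp_eq F_monic ('X^j * q).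
  rewrite -/(r j) => ->.
  by rewrite ED -mulNr !EM; apply: SD; apply: SM.
have nuD u v : nu (u + v) = nu u + nu v by rewrite /nu rmorphD.
have nuM u v : nu (u * v) = nu u * nu v by rewrite /nu rmorphM.
have nuX j : nu 'X^j = 'X^j by rewrite /nu map_polyXn.
have nur j : (j < d)%N -> nu (r j) = 'X^j.
  move=> lt_jd; have /(congr1 nu) := Pdiv.RingMonic.rdivp_eq F_monic ('X^j * q).
  rewrite nuD !nuM nuq1 mulr1 nuX => Ej.
  have nuF_monic : nu F \is monic by apply: monic_map.
  have size_nuF : size (nu F) = d.+1.
    have l1 : (lead_coef F).@[a] != 0 by rewrite (eqP F_monic) meval1 oner_eq0.
    by rewrite /nu size_map_poly_id0 // sF.
  have := congr1 (fun u => rmodp u (nu F)) Ej => /=.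
  rewrite Pdiv.RingMonic.rmodp_addl_mul_small //; last first.
    by rewrite size_nuF ltnS (leq_trans _ (r_size j)) // size_poly.
  by rewrite rmodp_small ?size_polyXn ?size_nuF.
have d_gt0 : (0 < d)%N.
  rewrite lt0n; apply/eqP => d0; apply: S1.
  have F1 : F = 1.
    have /size_poly1P[c _ Fc] : size F == 1 by rewrite sF d0.
    by move: F_monic; rewrite Fc monicE lead_coefC => /eqP->.
  by move: SF; rewrite /E F1 /= rmorph1 /horner_eval hornerC.
pose M : 'M[{mpoly C[n]}]_d := \matrix_(j, k) (r j)`_k.
pose m := map_mx (mmap iota y) M.
have Sm j : S (\sum_k m j k * t ^+ k).
  suff -> : \sum_k m j k * t ^+ k = E (r j) by [].
  rewrite /E /= /horner_eval (@horner_coef_wide _ d) ?(leq_trans (size_poly _ _)) //.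
  by apply: eq_bigr => k _; rewrite !mxE coef_map.
have Sdet : S (\det m).
  have := S_sum (enum 'I_d) (fun j => SM (\adj m (Ordinal d_gt0) j) (Sm j)).
  rewrite big_enum /=.
  under eq_bigr do rewrite mulr_sumr.
  rewrite exchange_big /= (bigD1 (Ordinal d_gt0)) //= [X in _ + X]big1 => [|k neq_k].
    under eq_bigr do rewrite /= expr0 mulr1.
    have /matrixP/(_ (Ordinal d_gt0) (Ordinal d_gt0)) := mul_adj_mx m.
    by rewrite mxE => ->; rewrite mxE eqxx mulr1n addr0.
  under eq_bigr do rewrite mulrA.
  have /matrixP/(_ (Ordinal d_gt0) k) := mul_adj_mx m.
  rewrite mxE -mulr_suml => ->; rewrite mxE eq_sym (negbTE neq_k).
  by rewrite mulr0n mul0r.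
have : (\det M).@[a] = 0 by apply: aP; rewrite -det_map_mx.
rewrite -[_.@[a]]/(meval a _) -det_map_mx (_ : map_mx _ _ = 1%:M) ?det1.
  by move/eqP; rewrite oner_eq0.
apply/matrixP => j k; rewrite !mxE; have /polyP/(_ k) := nur j (ltn_ord j).
by rewrite coef_map coefXn eq_sym.
Qed.

(** The specialized relations form an ideal of C[X], nonzero because of the monic [nu F] and proper
    by [specialization_proper]. A root of an element of least degree is a common root. *)
Lemma specialization_root : exists b, forall q, S (E q) -> (nu q).[b] = 0.
Proof.
have ED u v : E (u + v) = E u + E v by rewrite /E /= !rmorphD.
have EM u v : E (u * v) = E u * E v by rewrite /E /= !rmorphM.
have nuD u v : nu (u + v) = nu u + nu v by rewrite /nu rmorphD.
have nuM u v : nu (u * v) = nu u * nu v by rewrite /nu rmorphM.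
pose P k := `[< exists q, [/\ S (E q), nu q != 0 & size (nu q) = k] >].
have exP : exists k, P k.
  exists (size (nu F)); apply/asboolP; exists F; split=> //.
  by rewrite monic_neq0 ?monic_map.
have [k /asboolP[q0 [Sq0 nz_q0 <-]] min_q0] := ex_minnP exP.
have [b b0] : exists b, root (nu q0) b.
  apply/closed_rootP; apply/eqP => size1.
  have /size_poly1P[c c0 nuE] : size (nu q0) == 1%N by rewrite size1.
  have /specialization_proper/eqP : S (E ((c^-1)%:MP%:P * q0)) by rewrite EM; apply: SM.
  case; rewrite nuM nuE /nu map_polyC /= -polyCM.
  by rewrite [X in X * _](mevalC a) mulVf.
exists b => q Sq; rewrite (divp_eq (nu q) (nu q0)) hornerD hornerM (rootP b0) mulr0 add0r.
suff -> : nu q %% nu q0 = 0 by rewrite horner0.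
apply/eqP/negPn/negP => nz_mod.
suff : (size (nu q0) <= size (nu q %% nu q0)%R)%N by rewrite leqNgt ltn_modp nz_q0.
pose u : {poly {mpoly C[n]}} := map_poly (@mpolyC n C) (- (nu q %/ nu q0)).
have nu_u : nu u = - (nu q %/ nu q0).
  by apply/polyP => i; rewrite !coef_map; apply: mevalC.
have modE : nu (q + u * q0) = nu q %% nu q0.
  rewrite nuD nuM nu_u mulNr {1}(divp_eq (nu q) (nu q0)).
  by rewrite addrAC subrr add0r.
apply: min_q0; apply/asboolP; exists (q + u * q0); rewrite modE; split=> //.
by rewrite ED EM; apply: SD => //; apply: SM.
Qed.

End Specialization.

(** Induction by Noether normalization. Without nonzero relations modulo [S] any point works.
    Otherwise substituting x_i = y_i + lam_i t makes a relation [f] monic in t up to a constant,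
    provided its leading form does not vanish at [lam]; the point found for [y] extends by
    [specialization_root]. *)
Lemma nullstellensatz n (x : 'I_n -> A) :
  exists a : 'I_n -> C, forall p, S (mmap iota x p) -> p.@[a] = 0.
Proof.
elim: n x => [|n IH] x.
  exists (fun=> 0) => p; rewrite {1}(mpoly0_const p (fun=> 0)) mmapC; exact: S_ring.
have [Sx0|] := EM (forall p, S (mmap iota x p) -> p = 0).
  by exists (fun=> 0) => p /Sx0 ->; rewrite meval0.
move=> /existsNP[f /not_implyP[Sf /eqP f0]].
pose d := mdeg (mlead f).
pose fd : {mpoly C[n.+1]} := \sum_(m <- msupp f) (f@_m * (mdeg m == d)%:R) *: 'X_[m].
have fd0 : fd != 0.
  apply: contra_neq f0 => fd0; apply/eqP; rewrite -mleadc_eq0.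
  apply/eqP; transitivity (fd@_(mlead f)); last by rewrite fd0 mcoeff0.
  rewrite raddf_sum /=; have [mf|mf] := boolP (mlead f \in msupp f).
    rewrite (bigD1_seq (mlead f)) //= mcoeffZ mcoeffX !eqxx !mulr1.
    rewrite big1 ?addr0 // => m /negbTE neq.
    by rewrite mcoeffZ mcoeffX neq mulr0.
  rewrite memN_msupp_eq0 // big_seq big1 // => m mf'.
  by rewrite mcoeffZ mcoeffX (negbTE (memPn mf _ mf')) mulr0.
(* The extra variable forces the last coordinate of [lam] to be nonzero, so that t can be a multiple
   of the last x. *)
have [lam] : exists lam, (fd * 'X_ord_max).@[lam] != 0.
  apply: mpoly_neq0_meval; rewrite mulf_neq0 //.
  apply/eqP => /(congr1 (meval (fun=> 1))); rewrite mevalXU meval0 => /eqP.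
  by rewrite oner_eq0.
rewrite mevalM mevalXU mulf_eq0 negb_or => /andP[fdl lmax0].
have [t tE] : exists t, iota (lam ord_max) * t = x ord_max.
  exists (iota (lam ord_max)^-1 * x ord_max).
  by rewrite mulrA -rmorphM divff // rmorph1 mul1r.
pose y j : A := x (lift ord_max j) - iota (lam (lift ord_max j)) * t.
have [a aP] := IH y.
pose c : 'I_n.+1 -> {mpoly C[n]} := ord_rcons (fun j => 'X_j) 0.
pose h i : {poly {mpoly C[n]}} := (c i)%:P + ((lam i)%:MP)%:P * 'X.
pose sigma : {mpoly C[n.+1]} -> {poly {mpoly C[n]}} := mmap (polyC \o @mpolyC n C) h.
have sigma_top m : let q := mmap1 h m in
    (size q <= (mdeg m).+1)%N /\ q`_(mdeg m) = (\prod_i lam i ^+ m i)%:MP.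
  have [ks <- ksP] := monomial_list m.
  rewrite /mmap1 !ksP rmorph_prod; exact: prod_linear_top.
have mdeg_le m : m \in msupp f -> (mdeg m <= d)%N.
  by move=> mf; rewrite -ltnS mlead_deg ?msize_mdeg_lt.
have sigmaE : sigma f = \sum_(m <- msupp f) (f@_m)%:MP%:P * mmap1 h m by [].
have size_sf : (size (sigma f) <= d.+1)%N.
  rewrite sigmaE big_seq; apply: (big_ind (fun q : {poly _} => size q <= d.+1)%N).
  - by rewrite size_poly0.
  - by move=> q r sq sr; rewrite (leq_trans (size_polyD _ _)) // geq_max sq.
  move=> m mf; rewrite mul_polyC (leq_trans (size_scale_leq _ _)) //.
  by rewrite (leq_trans (sigma_top m).1) // ltnS mdeg_le.
have coef_sf : (sigma f)`_d = (fd.@[lam])%:MP.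
  have -> : fd.@[lam] = \sum_(m <- msupp f)
      f@_m * ((mdeg m == d)%:R * \prod_i lam i ^+ m i).
    rewrite /fd raddf_sum; apply: eq_bigr => m _.
    by rewrite [LHS]mevalZ mevalX mulrA.
  rewrite sigmaE coef_sum raddf_sum; apply: eq_big_seq => m mf.
  rewrite coefCM [RHS]mpolyCM mpolyCM; congr (_ * _).
  have := mdeg_le m mf; rewrite leq_eqVlt => /orP[/eqP <-|lt_md].
    by rewrite eqxx mpolyC1 mul1r (sigma_top m).2.
  rewrite (ltn_eqF lt_md) mpolyC0 mul0r nth_default //.
  by rewrite (leq_trans (sigma_top m).1).
pose F := ((fd.@[lam])^-1)%:MP%:P * sigma f.
have F_monic : F \is monic.
  have Fd : F`_d = 1 by rewrite coefCM coef_sf -mpolyCM mulVf ?mpolyC1.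
  have size_F : size F = d.+1.
    apply/eqP; rewrite eqn_leq; apply/andP; split.
      by rewrite /F mul_polyC (leq_trans (size_scale_leq _ _)).
    rewrite ltnNge; apply: contra_neqN (oner_neq0 {mpoly C[n]}) => le_Fd.
    by rewrite -Fd nth_default.
  by rewrite monicE lead_coefE size_F Fd.
have Esigma p : (map_poly (mmap iota y) (sigma p)).[t] = mmap iota x p.
  rewrite -[LHS]/((horner_eval t \o map_poly (mmap iota y)) (sigma p)).
  rewrite mmap_comp; apply: mmap_ext => [e|i] /=.
    by rewrite map_polyC /= /horner_eval hornerC mmapC.
  rewrite /h rmorphD rmorphM /= !map_polyC map_polyX /= /horner_eval !hornerE !mmapC.
  rewrite /c; case: (unliftP ord_max i) => [j|] ->.
    by rewrite ord_rcons_lift mmapX mmap1U /y subrK.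
  by rewrite ord_rcons_max mmap0 add0r.
have SF : S ((map_poly (mmap iota y) F).[t]).
  by rewrite /F rmorphM /= hornerM Esigma; apply: SM.
have [b bP] := specialization_root aP F_monic SF.
exists (fun i => ord_rcons a 0 i + lam i * b) => p Sp.
rewrite -[RHS](bP (sigma p)); last by rewrite -[X in S X]/((map_poly _ _).[t]) Esigma.
rewrite -[RHS]/((horner_eval b \o map_poly (meval a)) (sigma p)) [RHS]mmap_comp.
rewrite /meval; apply: mmap_ext => [e|i] /=.
  by rewrite map_polyC /= /horner_eval hornerC mevalC.
rewrite /h rmorphD rmorphM /= !map_polyC map_polyX /= /horner_eval !hornerE.
rewrite [X in _ = _ + X * _](mevalC a); congr (_ + _).
rewrite /c; case: (unliftP ord_max i) => [j|] ->.
  by rewrite !ord_rcons_lift [RHS]mevalXU.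
by rewrite !ord_rcons_max [RHS]meval0.
Qed.

End Nullstellensatz.

(** * Closure properties of regular functions *)

Section RegularFunctions.
Local Open Scope ring_scope.
Variables (C : fieldType) (Y : Type) (n : nat) (e : Y -> 'I_n -> C).
Implicit Types f h : Y -> C.

Lemma regular_cst a : regular e (fun=> a).
Proof. by exists a%:MP => y; rewrite mevalC. Qed.

Lemma regular_coord k : regular e (fun y => e y k).
Proof. by exists 'X_k => y; rewrite mevalXU. Qed.

Lemma regular_eq f h : f =1 h -> regular e h -> regular e f.
Proof. by move=> fh [p hp]; exists p => y; rewrite fh. Qed.

Lemma regularD f h : regular e f -> regular e h -> regular e (fun y => f y + h y).
Proof. by move=> [p fp] [q hq]; exists (p + q) => y; rewrite mevalD fp hq. Qed.

Lemma regularM f h : regular e f -> regular e h -> regular e (fun y => f y * h y).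
Proof. by move=> [p fp] [q hq]; exists (p * q) => y; rewrite mevalM fp hq. Qed.

Lemma regular_sum (I : Type) (r : seq I) (F : I -> Y -> C) :
  (forall i, regular e (F i)) -> regular e (fun y => \sum_(i <- r) F i y).
Proof.
move=> rF; elim: r => [|i r IH].
  by under eq_fun do rewrite big_nil; apply: regular_cst.
by under eq_fun do rewrite big_cons; apply: regularD.
Qed.

Lemma regular_comp m (p : {mpoly C[m]}) (h : 'I_m -> Y -> C) :
  (forall k, regular e (h k)) -> regular e (fun y => p.@[fun k => h k y]).
Proof.
move=> /choice[q hq]; exists (p \mPo [tuple q k | k < m]) => y.
by rewrite comp_mpoly_meval; apply: meval_eq => k; rewrite tnth_mktuple hq.
Qed.

Lemma regular_mulmx p q r (A : Y -> 'M[C]_(p, q)) (B : Y -> 'M[C]_(q, r)) :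
  (forall i j, regular e (fun y => A y i j)) ->
  (forall i j, regular e (fun y => B y i j)) ->
  forall i j, regular e (fun y => (A y *m B y) i j).
Proof.
move=> rA rB i j; under eq_fun do rewrite mxE.
by apply: regular_sum => k; apply: regularM.
Qed.

End RegularFunctions.

(** * The Reynolds operator *)

Section Reynolds.
Local Open Scope ring_scope.
Local Open Scope quotient_scope.
Variables (C : numClosedFieldType) (G : groupType) (s : nat) (g : 'I_s -> G).
Hypothesis g_gen : generates g.
Implicit Types (rho : rep C G) (f : rep C G -> C).
Local Notation e := (@rep_coord C G s g).

Lemma rep_wval rho w : rho (wval g w) = wval (rho \o g) w.
Proof. by rewrite wval_morph //; apply: gmulfM. Qed.

Lemma rep_coord_rank rho l i j :
  rep_coord g rho (enum_rank (l, i, j)) = adjoint (rho (g l)) i j.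
Proof. by rewrite /rep_coord enum_rankK. Qed.

Lemma conj_repE P rho x : conj_rep P rho x = (P * rho x * P^-1)%g.
Proof. by []. Qed.

Lemma regular_adjoint_word w i j :
  regular e (fun rho => adjoint (rho (wval g w)) i j).
Proof.
elim: w i j => [|[l b] w IH] i j /=.
  by under eq_fun do rewrite gmulf1 adjoint1; apply: regular_cst.
under eq_fun do rewrite gmulfM adjointM; apply: regular_mulmx => // {}i {}j.
have rl i' j' : regular e (fun rho => adjoint (rho (g l)) i' j').
  by under eq_fun do rewrite -rep_coord_rank; apply: regular_coord.
by case: b => //=; under eq_fun do rewrite gmulfV adjointV mxE.
Qed.

Lemma regular_character x : regular e (fun rho => character rho x).
Proof.
have [w <-] := wval_generates g_gen x.
under eq_fun do rewrite /character tr2_adjoint.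
apply: regularD; last exact: regular_cst.
by apply: regular_sum => i; apply: regular_adjoint_word.
Qed.

Lemma character_conj P rho : character (conj_rep P rho) = character rho.
Proof.
apply: funext => x; rewrite /character !tr2_adjoint; congr (_ + 1).
rewrite conj_repE !adjointM mxtrace_mulC mulmxA.
by rewrite -adjointM mulVg adjoint1 mul1mx.
Qed.

Definition reynolds (S : seq (C * SL2 C)) f rho : C :=
  \sum_(q <- S) q.1 * f (conj_rep (\pi_(PSL2 C) q.2) rho).

Lemma reynolds_regular S f : regular e f -> regular e (reynolds S f).
Proof.
move=> [p fp]; apply: regular_sum => q; apply: regularM; first exact: regular_cst.
under eq_fun do rewrite fp; apply: regular_comp => k.
rewrite -[k]enum_valK; case: (enum_val k) => -[l i] j.
under eq_fun do rewrite enum_rankK conj_repE !adjointM.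
apply: regular_mulmx => [{}i {}j|{}i {}j]; last exact: regular_cst.
apply: regular_mulmx => [{}i {}j|{}i {}j]; first exact: regular_cst.
by under eq_fun do rewrite -rep_coord_rank; apply: regular_coord.
Qed.

Lemma reynoldsM S f h : Defs.invariant h ->
  reynolds S (fun rho => f rho * h rho) = fun rho => reynolds S f rho * h rho.
Proof.
move=> hi; apply: funext => rho; rewrite /reynolds mulr_suml.
by apply: eq_bigr => q _; rewrite hi mulrA.
Qed.

Lemma reynolds_id S N f : cubature S N -> Defs.invariant f -> reynolds S f = f.
Proof.
move=> SN fi; apply: funext => rho; rewrite /reynolds.
under eq_bigr do rewrite fi; rewrite -mulr_suml.
have := SN 0 0 0 0 isT isT isT isT; rewrite /= beta_i0 invr1.
by under eq_bigr do rewrite !expr0 !mulr1; move->; rewrite mul1r.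
Qed.

Lemma reynolds_sum S (I : Type) (r : seq I) (F : I -> rep C G -> C) :
  reynolds S (fun rho => \sum_(i <- r) F i rho)
  = fun rho => \sum_(i <- r) reynolds S (F i) rho.
Proof.
apply: funext => rho; rewrite /reynolds exchange_big.
by apply: eq_bigr => q _; rewrite mulr_sumr.
Qed.

Definition rep_lift rho (l : 'I_s) : SL2 C := repr (rho (g l)).

Lemma rep_lift_word rho w : \pi_(PSL2 C) (wval (rep_lift rho) w) = rho (wval g w).
Proof.
rewrite rep_wval -(wval_morph _ _ (@pi_mulg C)).
by congr (wval _ w); apply: funext => l /=; rewrite reprK.
Qed.

Lemma sl2_inv_skew (A : SL2 C) :
  (A^-1)%g = - (skew2 C *m (A : 'M_2)^T *m skew2 C) :> 'M_2.
Proof.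
rewrite sl2_valV; have [a00 a01 a10 a11] := adj2E (A : 'M_2).
apply: matrix2P; rewrite ?a00 ?a01 ?a10 ?a11 [RHS]mxE !mulmx2E !mxE /=;
  entries (A : 'M_2); ring.
Qed.

(* Entries of the adjoint matrix of [P z_l P^-1] as polynomials in the entries
   of [P], written with [P z_l P^-1 = - (P z_l E P^T) E] for [E = skew2]. *)
Definition adjoint_form (z : 'I_s -> SL2 C) (k : 'I_s * 'I_3 * 'I_3) :
    {mpoly C[2 * 2]} :=
  \sum_(a : 'I_2 * 'I_2 * 'I_2 * 'I_2)
    ((skew2 C *m pauli C k.1.2) a.2 a.1.1.1 * (skew2 C *m pauli C k.2) a.1.1.2 a.1.2 / 2)
    *: (item_form z (a.1.1.1, a.1.1.2, [:: (k.1.1, true)])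
        * item_form z (a.1.2, a.2, [:: (k.1.1, false)])).

Lemma mxtrace2_mul4 (K U L V : 'M[C]_2) : \tr (K *m U *m (L *m V)) =
  \sum_(a : 'I_2 * 'I_2 * 'I_2 * 'I_2)
    K a.2 a.1.1.1 * L a.1.1.2 a.1.2 * (U a.1.1.1 a.1.1.2 * V a.1.2 a.2).
Proof.
pose T a b c d := K d a * L b c * (U a b * V c d).
rewrite -(pair_bigA _ (fun p d => T p.1.1 p.1.2 p.2 d)) /=.
rewrite -(pair_bigA _ (fun p c => \sum_d T p.1 p.2 c d)) /=.
rewrite -(pair_bigA _ (fun a b => \sum_c \sum_d T a b c d)) /= /T.
rewrite !sum_ord2 mxtrace2E !mulmx2E; entries K; entries U; entries L; entries V.
ring.
Qed.

Lemma adjoint_form_eval z k (A : SL2 C) :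
  (adjoint_form z k).@[mxvec (A : 'M_2) 0]
  = sl2_adjoint (A * z k.1.1 * A^-1)%g k.1.2 k.2.
Proof.
case: k => -[l i] j /=; rewrite /adjoint_form raddf_sum [RHS]mxE.
pose E := skew2 C; pose Q (D : SL2 C) := (A : 'M_2) *m ((D : 'M_2) *m E) *m (A : 'M_2)^T.
have conjE (D : SL2 C) : (A * D * A^-1)%g = - (Q D *m E) :> 'M_2.
  by rewrite !sl2_valM sl2_inv_skew mulmxN /Q /E !mulmxA.
rewrite -[invmx _]/(((A * z l * A^-1)^-1)%g : 'M_2) !invgM invgK [(A * (_ * _))%g]mulgA.
have trE (K L U V : 'M[C]_2) : \tr (K *m (- (U *m E) *m L *m - (V *m E))) =
    \tr (E *m K *m U *m (E *m L *m V)).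
  by rewrite !(mulmxN, mulNmx) opprK !mulmxA mxtrace_mulC !mulmxA.
rewrite !conjE trE mxtrace2_mul4 mulr_suml; apply: eq_bigr => a _.
have w b : wval z [:: (l, b)] = (if b then z l else (z l)^-1)%g by apply: mulg1.
by rewrite [LHS]mevalZ mevalM !form_eval !w mulrAC.
Qed.

(** Expanding an adjoint entry adds two forms, for a letter and its inverse: parities are kept, and
    [size ks] counts twice in the bound. *)
Lemma mean_adjoint_forms_agree S N (x y : 'I_s -> SL2 C) ks its :
    cubature S N ->
    (forall w, \tr (wval x w : 'M_2) ^+ 2 = \tr (wval y w : 'M_2) ^+ 2) ->
    ((size its + (size ks).*2).*2 <= N)%N ->
    (forall k, ~~ odd (wletter k (letters [::] its))) ->
  mean S (items_form x its * \prod_(k <- ks) adjoint_form x k) =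
  mean S (items_form y its * \prod_(k <- ks) adjoint_form y k).
Proof.
move=> SN xy; elim: ks its => [|k ks IH] its le_N ev.
  have := mean_items_agree SN xy (vs := [::]) (its := its).
  rewrite addn0 in le_N; rewrite 2!big_nil 2!mul1r => /(_ le_N ev).
  by rewrite [X in _ * X]big_nil [X in _ = mean _ (_ * X)]big_nil 2!mulr1.
pose its' (a : 'I_2 * 'I_2 * 'I_2 * 'I_2) : seq (item s) :=
  [:: (a.1.1.1, a.1.1.2, [:: (k.1.1, true)]), (a.1.2, a.2, [:: (k.1.1, false)]) & its].
have E (z : 'I_s -> SL2 C) : mean S (items_form z its * \prod_(k <- k :: ks) adjoint_form z k) =
    \sum_(a : 'I_2 * 'I_2 * 'I_2 * 'I_2)
    ((skew2 C *m pauli C k.1.2) a.2 a.1.1.1 * (skew2 C *m pauli C k.2) a.1.1.2 a.1.2 / 2)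
    * mean S (items_form z (its' a) * \prod_(k <- ks) adjoint_form z k).
  rewrite big_cons mulrCA {1}/adjoint_form mulr_suml mean_sum.
  by apply: eq_bigr => a _; rewrite -scalerAl meanZ /items_form !big_cons !mulrA.
have Ea a := IH (its' a); move: (E x) (E y) => Ex Ey.
refine (etrans Ex (etrans _ (esym Ey))).
apply: eq_bigr => a _; refine (congr1 _ (Ea a _ _)).
  by rewrite /= doubleS !addnS in le_N *.
move=> i; have := ev i; rewrite /letters /= /wletter /=; case: (k.1.1 == i) => //=.
by rewrite negbK.
Qed.

(** [D] depends on [f] alone, so one cubature can serve several functions. For arbitrary [f] this
    makes [reynolds S f] invariant, conjugate representations having equal characters. *)
Lemma reynolds_agree f : regular e f -> exists D, forall S N rho rho',
  (D <= N)%N -> cubature S N -> character rho = character rho' ->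
  reynolds S f rho = reynolds S f rho'.
Proof.
(* An entry of the adjoint matrix of P z P^-1 has degree 4 in the entries of P. *)
case=> p fp; exists (4 * msize p)%N => S N rho rho' le_DN SN eq_char.
have tr_lift r w : \tr (wval (rep_lift r) w : 'M_2) ^+ 2 = character r (wval g w).
  by rewrite /character -rep_lift_word tr2_pi.
have xy w : \tr (wval (rep_lift rho) w : 'M_2) ^+ 2
          = \tr (wval (rep_lift rho') w : 'M_2) ^+ 2.
  by rewrite !tr_lift eq_char.
have E r : reynolds S f r = \sum_(m <- msupp p) p@_m *
    \sum_(q <- S) q.1 * \prod_i e (conj_rep (\pi_(PSL2 C) q.2) r) i ^+ m i.
  rewrite /reynolds; under eq_bigr do rewrite fp mevalE mulr_sumr.
  rewrite exchange_big; apply: eq_bigr => m _; rewrite mulr_sumr.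
  by apply: eq_bigr => q _; rewrite mulrCA.
rewrite !E; apply: eq_big_seq => m mp; congr (_ * _).
have [ks size_ks ksP] := monomial_list m.
pose ts := [seq enum_val k | k <- ks].
have M r : \sum_(q <- S) q.1 * \prod_i e (conj_rep (\pi_(PSL2 C) q.2) r) i ^+ m i
    = mean S (items_form (rep_lift r) [::] * \prod_(k <- ts) adjoint_form (rep_lift r) k).
  rewrite /items_form big_nil mul1r; apply: eq_bigr => q _; congr (_ * _).
  rewrite ksP rmorph_prod big_map; apply: eq_bigr => k _.
  rewrite [RHS]adjoint_form_eval /rep_coord; case: (enum_val k) => -[l i] j /=.
  by rewrite conj_repE -adjoint_pi !pi_mulg pi_invg reprK.
rewrite !M; apply: (mean_adjoint_forms_agree SN xy) => //.
rewrite add0n size_map size_ks; apply: leq_trans le_DN.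
by rewrite -!muln2 -mulnA mulnC leq_mul2l /= ltnW // msize_mdeg_lt.
Qed.

Lemma invariant_agree f rho rho' : regular e f -> Defs.invariant f ->
  character rho = character rho' -> f rho = f rho'.
Proof.
move=> fr fi eq_char; have [D DP] := reynolds_agree fr.
have [S SD] := sl2_cubature C D.
by rewrite -(reynolds_id SD fi); apply: DP SD eq_char.
Qed.

End Reynolds.

(** * The representation variety and its quotient *)

Section RepresentationVariety.
Local Open Scope ring_scope.
Local Open Scope quotient_scope.
Variables (C : numClosedFieldType) (G : groupType) (s : nat) (g : 'I_s -> G).
Hypothesis g_gen : generates g.
Implicit Types (rho : rep C G).
Local Notation e := (@rep_coord C G s g).
Local Notation n := #|{: 'I_s * 'I_3 * 'I_3}|.
Local Notation polynomial := (@regular C ('I_n -> C) n (fun v => v)).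
Implicit Types v : 'I_n -> C.

Definition coord_mx v (l : 'I_s) : 'M[C]_3 := \matrix_(i, j) v (enum_rank (l, i, j)).

Lemma coord_mx_rep rho l : coord_mx (e rho) l = adjoint (rho (g l)).
Proof. by apply/matrixP => i j; rewrite mxE rep_coord_rank. Qed.

Lemma polynomial_coord_mx l i j : polynomial (fun v => coord_mx v l i j).
Proof.
apply: (regular_eq (h := fun v => v (enum_rank (l, i, j)))) => [v|]; first by rewrite mxE.
exact: regular_coord.
Qed.

(** Inverse letters use the transpose: it is the inverse on adjoint matrices and stays polynomial at
    every point. *)
Definition word_mx v (w : word s) : 'M[C]_3 :=
  foldr (fun l M => (if l.2 then coord_mx v l.1 else (coord_mx v l.1)^T) *m M) 1%:M w.

Lemma polynomial_word_mx w i j : polynomial (fun v => word_mx v w i j).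
Proof.
elim: w i j => [|[l b] w IH] i j /=; first exact: regular_cst.
apply: regular_mulmx => // {}i {}j; case: b => /=; first exact: polynomial_coord_mx.
apply: (regular_eq (h := fun v => coord_mx v l j i)) => [v|]; first by rewrite mxE.
exact: polynomial_coord_mx.
Qed.

Lemma adjoint_wval (x : 'I_s -> PSL2 C) v w :
  (forall l, adjoint (x l) = coord_mx v l) -> adjoint (wval x w) = word_mx v w.
Proof.
move=> xv; elim: w => [|[l b] w IH] /=; first exact: adjoint1.
by rewrite adjointM IH; case: b; rewrite /= ?adjointV xv.
Qed.

Lemma polynomial_conj_pauli l k a b :
  polynomial (fun v => conj_pauli (coord_mx v l) k a b).
Proof.
pose h v := \sum_i coord_mx v l i k * pauli C i a b.
apply: (regular_eq (h := h)) => [v|].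
  by rewrite summxE; apply: eq_bigr => i _; rewrite mxE.
apply: regular_sum => i; apply: regularM; last exact: regular_cst.
exact: polynomial_coord_mx.
Qed.

Section Closure.
Variable z : 'I_n -> C.
Hypothesis z_closure : forall p : {mpoly C[n]},
  (forall rho, p.@[e rho] = 0) -> p.@[z] = 0.

Lemma closure_eq (h h' : ('I_n -> C) -> C) : polynomial h -> polynomial h' ->
  (forall rho, h (e rho) = h' (e rho)) -> h z = h' z.
Proof.
move=> [p hp] [q hq] eq_h; apply/eqP; rewrite -subr_eq0 hp hq -mevalB.
by apply/eqP/z_closure => rho; rewrite mevalB -hp -hq eq_h subrr.
Qed.

Lemma closure_conj_multiplicative l : conj_multiplicative (coord_mx z l).
Proof.
move=> k k'; apply/matrixP => a b.
apply: (closure_eq (h := fun v => (conj_pauli (coord_mx v l) k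
  *m conj_pauli (coord_mx v l) k') a b) (h' := fun v => conj_map (coord_mx v l)
  (pauli C k *m pauli C k') a b)).
- by apply: regular_mulmx => c d; apply: polynomial_conj_pauli.
- pose Y := pauli C k *m pauli C k'.
  pose h v := (\tr Y / 2)%:M a b
    + \sum_i \tr (pauli C i *m Y) / 2 * conj_pauli (coord_mx v l) i a b.
  apply: (regular_eq (h := h)) => [v|].
    by rewrite mxE summxE; congr (_ + _); apply: eq_bigr => i _; rewrite mxE.
  apply: regularD; first exact: regular_cst.
  apply: regular_sum => i; apply: regularM; first exact: regular_cst.
  exact: polynomial_conj_pauli.
move=> rho; rewrite coord_mx_rep; elim/quotW: (rho (g l)) => A.
by rewrite adjoint_pi adjoint_conj_multiplicative.
Qed.

(** R(G) is Zariski closed. At [z] the matrices satisfy [conj_multiplicative], so they lift to SL_2.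
    Words equal in G have equal matrices at [z], hence equal values in PSL_2. All such pairs of
    words serve as relations. *)
Lemma rep_of_closure : exists rho, e rho = z.
Proof.
have /choice[A AE] l := sl2_adjoint_surj (closure_conj_multiplicative l).
pose x l := \pi_(PSL2 C) (A l).
have xz l : adjoint (x l) = coord_mx z l by rewrite adjoint_pi AE.
have /choice[om omE] := wval_generates g_gen.
have x_rel w w' : wval g w = wval g w' -> wval x w = wval x w'.
  move=> eq_g; apply: adjoint_inj; rewrite !(adjoint_wval _ xz).
  apply/matrixP => i j.
  apply: (closure_eq (h := fun v => word_mx v w i j) (h' := fun v => word_mx v w' i j)).
  - exact: polynomial_word_mx.
  - exact: polynomial_word_mx.
  move=> rho; have rhoE l : adjoint ((rho \o g) l) = coord_mx (e rho) l.
    by rewrite coord_mx_rep.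
  by rewrite -!(adjoint_wval _ rhoE) -!rep_wval eq_g.
pose f a := wval x (om a).
have f_morph : monoid.monoid_morphism f.
  split=> [|a b]; first by rewrite /f (x_rel _ [::]) // omE.
  by rewrite /f -wval_cat; apply: x_rel; rewrite wval_cat !omE.
pose rho : rep C G := HB.pack f (isUMagmaMorphism.Build G (PSL2 C) f f_morph).
exists rho; apply: funext => k; rewrite -[k]enum_valK.
case: (enum_val k) => -[l i] j; rewrite rep_coord_rank.
have -> : rho (g l) = x l.
  rewrite -[rho _]/(f (g l)) /f (x_rel _ [:: (l, true)]) ?omE //= ?mulg1 //.
by rewrite xz mxE.
Qed.

End Closure.

(** The ideal [S] contains every polynomial vanishing on R(G). Were it proper, its zero would be a
    representation at which every [f i] vanishes. *)
Lemma rep_nullstellensatz m (f : 'I_m -> rep C G -> C) :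
    (forall i, regular e (f i)) -> (forall rho, exists i, f i rho != 0) ->
  exists h : 'I_m -> rep C G -> C, (forall i, regular e (h i)) /\
    forall rho, \sum_i h i rho * f i rho = 1.
Proof.
move=> f_reg f_nz.
pose S (p : {mpoly C[n]}) := exists h : 'I_m -> rep C G -> C,
  (forall i, regular e (h i)) /\ forall rho, p.@[e rho] = \sum_i h i rho * f i rho.
have [[h [h_reg h1]]|S1] := EM (S 1).
  by exists h; split=> // rho; rewrite -h1 meval1.
have S0 p : (forall rho, p.@[e rho] = 0) -> S p.
  move=> p0; exists (fun _ _ => 0); split=> [i|rho]; first exact: regular_cst.
  by rewrite p0 big1 // => i _; rewrite mul0r.
have SD p q : S p -> S q -> S (p + q).
  move=> [h [hr hp]] [h' [hr' hq]]; exists (fun i rho => h i rho + h' i rho).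
  split=> [i|rho]; first exact: regularD.
  by rewrite mevalD hp hq -big_split; apply: eq_bigr => i _; rewrite mulrDl.
have SM p q : S q -> S (p * q).
  move=> [h [hr hq]]; exists (fun i rho => p.@[e rho] * h i rho).
  split=> [i|rho]; first by apply: regularM => //; exists p.
  by rewrite mevalM hq mulr_sumr; apply: eq_bigr => i _; rewrite mulrA.
(* Applied to the generic point, the variables themselves, where evaluating a polynomial gives it
   back. *)
have [z zP] := @nullstellensatz C {mpoly C[n]} (@mpolyC n C) S
  (S0 0 (fun rho => meval0 _)) SD SM S1 n (fun k => 'X_k).
have {}zP p : S p -> p.@[z] = 0.
  move=> Sp; apply: zP; rewrite -[X in S X]/(mmap _ _ p) (_ : mmap _ _ p = p) //.
  rewrite -[RHS]comp_mpoly_id; by apply: mmap_ext => // k; rewrite tnth_mktuple.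
have [rho rhoz] := rep_of_closure (fun p p0 => zP p (S0 p p0)).
have [i /eqP[]] := f_nz rho.
have [p fp] := f_reg i; rewrite fp rhoz; apply: zP.
exists (fun j _ => (j == i)%:R); split=> [j|r]; first exact: regular_cst.
rewrite (bigD1 i) //= eqxx mul1r big1 ?addr0 ?fp // => j /negbTE->.
by rewrite mul0r.
Qed.

Section Quotient.
Variables (m : nat) (X : set ('I_m -> C)) (t : rep C G -> X).
Hypothesis Xt : is_GIT_quotient g t.
Local Notation vX := (val : X -> 'I_m -> C).

Lemma git_coord_invariant i : Defs.invariant (fun rho => vX (t rho) i).
Proof.
have [sub _ _] := git_iso Xt.
by have [] := sub (fun x => vX x i) (regular_coord _ i).
Qed.

(* If [x0] were missed by [t], the Nullstellensatz would give regular [h_i] with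
   [sum_i h_i (t_i - x0_i) = 1] on R(G), invariant by the Reynolds operator, so
   that this identity would come from X, where it fails at [x0]. *)
Lemma git_surjective x0 : exists rho, t rho = x0.
Proof.
have [sub inj surj] := git_iso Xt.
apply: contrapT => /forallNP t_x0.
pose f i rho := vX (t rho) i - vX x0 i.
have f_inv i : Defs.invariant (f i).
  by move=> P rho; rewrite /f git_coord_invariant.
have [i|rho|h [h_reg h1]] := @rep_nullstellensatz m f.
- by apply: regularD; [exact: git_regular Xt i | exact: regular_cst].
- apply: contrapT => /forallNP f0; apply: (t_x0 rho); apply: val_inj.
  apply: funext => i; apply/eqP; rewrite -subr_eq0; apply/negPn/negP.
  exact: f0.
have /choice[D DP] i := reynolds_agree (h_reg i).
have [S SD] := sl2_cubature C (\sum_i D i).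
have r_inv i : Defs.invariant (reynolds S (h i)).
  move=> P rho; apply: DP SD _; first by rewrite (bigD1 i) //= leq_addr.
  exact: character_conj.
have /choice[k kP] i : exists k, regular vX k /\ k \o t = reynolds S (h i).
  have [k kr kE] : ((fun f => f \o t) @` regular vX)%classic (reynolds S (h i)).
    by apply: surj; split; [exact: reynolds_regular | exact: r_inv].
  by exists k.
pose K x := \sum_i k i x * (vX x i - vX x0 i).
have K_reg : regular vX K.
  apply: regular_sum => i; apply: regularM; first by have [] := kP i.
  by apply: regularD; [exact: regular_coord | exact: regular_cst].
have : K = (fun=> 1).
  apply: inj; rewrite ?inE //; first exact: regular_cst.
  rewrite -[RHS](reynolds_id SD (f := fun=> 1)) //.
  have <- : (fun rho => \sum_i h i rho * f i rho) = fun=> 1 by apply: funext.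
  rewrite reynolds_sum; apply: funext => rho; apply: eq_bigr => i _.
  by rewrite reynoldsM //; have [_ <-] := kP i.
move/(congr1 (fun F => F x0)) => /eqP; rewrite /K big1 => [|i _].
  by rewrite eq_sym oner_eq0.
by rewrite subrr mulr0.
Qed.

Lemma git_character rho rho' : t rho = t rho' <-> character rho = character rho'.
Proof.
have [sub inj surj] := git_iso Xt; split=> [eq_t|eq_char].
  apply: funext => x.
  have [k kr kE] : ((fun f => f \o t) @` regular vX)%classic (fun r => character r x).
    apply: surj; split; first exact: regular_character.
    by move=> P r; rewrite /= character_conj.
  have E r : k (t r) = character r x by apply: (congr1 (fun F => F r) kE).
  by rewrite -!E eq_t.
apply: val_inj; apply: funext => i.
apply: (invariant_agree (f := fun r => vX (t r) i) _ _ eq_char).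
  exact: git_regular Xt i.
exact: git_coord_invariant.
Qed.

End Quotient.
End RepresentationVariety.

Local Open Scope classical_set_scope.

Theorem theorem1p3 (R : realType) (Gamma : groupType)
    (s : nat) (g : 'I_s -> Gamma) (g_gen : generates g)
    (m : nat) (X : set ('I_m -> R[i])) (t : rep R[i] Gamma -> X)
    (Xt : is_GIT_quotient g t) :
  exists Phi : X -> (Gamma -> R[i]),
    set_bij [set: X] [set character rho | rho in [set: rep R[i] Gamma]] Phi /\
    forall rho : rep R[i] Gamma, Phi (t rho) = character rho.
Proof.
(* A section of [t]; its choice does not affect the characters, by [git_character]. *)
have /choice[r rK] := git_surjective g_gen Xt.
have PhiE rho : character (r (t rho)) = character rho.
  by apply/(git_character g_gen Xt); rewrite rK.
exists (fun x => character (r x)); split=> //; split.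
- by move=> x _ /=; exists (r x).
- by move=> x y _ _ /(git_character g_gen Xt); rewrite !rK.
- by move=> _ [rho _ <-]; exists (t rho).
Qed.
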